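(* Let $n\geq 1$ be an integer and let $p>1$ be a real number. The metric rank of $\mathcal{W}_p(\mathbb{H}^n)$ is $n$; that is, for a positive integer $k$, the Euclidean space $\mathbb{R}^k$ can be embedded isometrically into $\mathcal{W}_p(\mathbb{H}^n)$ if and only if $k\leq n$.
   Context: Heisenberg group: $\mathbb{H}^n=\mathbb{R}^n\times\mathbb{R}^n\times\mathbb{R}$ with the group operation $(x,y,z)\ast(x',y',z')=\big(x+x',\,y+y',\,z+z'+2\sum_{i=1}^n(x'_iy_i-x_iy'_i)\big)$. It is endowed with the left-invariant Heisenberg-Korányi metric $d_H((x,y,z),(x',y',z'))=\|(-x,-y,-z)\ast(x',y',z')\|_H$, where $\|(x,y,z)\|_H=\Big(\big(\sum_{i=1}^n(x_i^2+y_i^2)\big)^2+z^2\Big)^{1/4}$. Wasserstein space: for a complete separable metric space $(X,\varrho)$ and $p\geq1$, $\mathcal{W}_p(X)$ is the set of Borel probability measures $\mu$ on $X$ with $\int_X\varrho^p(x,\hat x)\,\mathrm{d}\mu(x)<\infty$ for some (hence all) $\hat x\in X$, endowed with the distance $d_{\mathcal{W}_p}(\mu,\nu)=\Big(\inf_{\Pi\in C(\mu,\nu)}\iint_{X\times X}\varrho^p(x,y)\,\mathrm{d}\Pi(x,y)\Big)^{1/p}$, where $C(\mu,\nu)$ is the set of couplings, i.e. Borel probability measures on $X\times X$ with marginals $\mu$ and $\nu$. Here $X=\mathbb{H}^n$ and $\varrho=d_H$. A map $f:(Y,d_Y)\to(Z,d_Z)$ between metric spaces is an isometric embedding if $d_Z(f(y),f(y'))=d_Y(y,y')$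 for all $y,y'\in Y$ (no surjectivity required). The metric rank of a metric space is the largest $k$ such that $\mathbb{R}^k$ with the Euclidean distance embeds isometrically into it. *)

(* Defs.v *)
From HB Require Import structures.
From mathcomp Require Import all_boot all_order all_algebra.
From mathcomp Require Import all_classical all_reals all_analysis.

Set Implicit Arguments.
Unset Strict Implicit.
Unset Printing Implicit Defensive.

Import Order.TTheory GRing.Theory Num.Theory.
Import numFieldNormedType.Exports.

Local Open Scope classical_set_scope.
Local Open Scope ring_scope.

(* The points of H^n are triples ((x, y), z). The topology and the norm that
   the library puts on this product play no role below. *)
Definition heisenberg (R : realType) (n : nat) : pointedType :=
  ('rV[R]_n * 'rV[R]_n * R)%type.

Section Heisenberg.
Context {R : realType} {n : nat}.
Implicit Types a b : heisenberg R n.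

Definition heis_mul a b : heisenberg R n :=
  (a.1.1 + b.1.1, a.1.2 + b.1.2,
   a.2 + b.2 + 2 * \sum_(i < n) (b.1.1 ord0 i * a.1.2 ord0 i
                                 - a.1.1 ord0 i * b.1.2 ord0 i)).

Definition heis_opp a : heisenberg R n := (- a.1.1, - a.1.2, - a.2).

Definition koranyi_norm a : R :=
  ((\sum_(i < n) (a.1.1 ord0 i ^+ 2 + a.1.2 ord0 i ^+ 2)) ^+ 2 + a.2 ^+ 2)
    `^ 4^-1.

Definition heis_dist a b : R := koranyi_norm (heis_mul (heis_opp a) b).

End Heisenberg.

(* X is a bare set here: its Borel sets are those of the metric rho. *)
Section Wasserstein.
Context {R : realType} {X : pointedType}.
Variable rho : X -> X -> R.

Definition metric_open : set (set X) :=
  [set A | forall x, A x ->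
     exists2 e : R, 0 < e & forall y, rho x y < e -> A y].

Definition borelType := g_sigma_algebraType metric_open.

Definition finite_moment (p : R) (mu : probability borelType R) : Prop :=
  exists x0 : X, (\int[mu]_x ((rho x x0) `^ p)%:E < +oo)%E.

Record wasserstein (p : R) := Wasserstein {
  wass_val :> probability borelType R;
  wass_moment : finite_moment p wass_val }.

(* Pi lives on the product of the two Borel sigma-algebras, which is the Borel
   sigma-algebra of X * X when (X, rho) is separable. *)
Definition coupling (mu nu : probability borelType R)
    : set (probability (borelType * borelType)%type R) :=
  [set Pi | (forall A : set borelType, measurable A ->
               Pi (fst @^-1` A) = mu A) /\
            (forall A : set borelType, measurable A ->
               Pi (snd @^-1` A) = nu A)].

Definition transport_cost (p : R)
    (Pi : probability (borelType * borelType)%type R) : \bar R :=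
  (\int[Pi]_z ((rho z.1 z.2) `^ p)%:E)%E.

Definition wass_dist (p : R) (mu nu : wasserstein p) : \bar R :=
  poweR (ereal_inf [set transport_cost p Pi | Pi in coupling mu nu]) p^-1.

End Wasserstein.

(* The library norm of 'rV[R]_k is the sup norm, hence the explicit formula. *)
Definition euclidean_dist {R : realType} {k : nat} (u v : 'rV[R]_k) : R :=
  Num.sqrt (\sum_(i < k) (u ord0 i - v ord0 i) ^+ 2).

(* The target distance takes values in \bar R so that wass_dist can be used
   as is; an isometric embedding forces the values involved to be finite. *)
Definition isometric_embedding {R : realType} {Y Z : Type}
    (dY : Y -> Y -> R) (dZ : Z -> Z -> \bar R) (f : Y -> Z) : Prop :=
  forall y y', dZ (f y) (f y') = (dY y y')%:E.

Definition euclidean_embeds {R : realType} {Z : Type}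
    (dZ : Z -> Z -> \bar R) (k : nat) : Prop :=
  exists f : 'rV[R]_k -> Z, isometric_embedding euclidean_dist dZ f.

Definition is_metric_rank {R : realType} {Z : Type}
    (dZ : Z -> Z -> \bar R) (m : nat) : Prop :=
  euclidean_embeds dZ m /\ forall k, euclidean_embeds dZ k -> (k <= m)%N.

(* Main.v *)
Require Import Defs.
From mathcomp Require Import all_boot all_order all_algebra.
From mathcomp Require Import all_classical all_reals all_analysis.
From mathcomp Require Import measurable_realfun ring lra.

(** A horizontal isotropic subspace such as R^n x 0 x 0 is isometric to R^n,
    and sending a point to its Dirac mass is isometric; this gives rank at
    least n.

    The upper bound comes from a rigidity of opposite rays. Suppose that f
    embeds R^k isometrically and that f 0 is the Dirac mass at the origin.
    Then the p-th moment of f v is |v|^p, so by the triangle inequality and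
    Minkowski's inequality every coupling of f (- v) and f v has cost at most
    (2 |v|)^p, which is the p-th power of their distance. Hence the product
    coupling is optimal and all these inequalities are equalities: for almost
    all independent points a, b one has |a| = |b| (strict convexity of t^p,
    this is where p > 1 enters) and d a b = |a| + |b|, and the latter forces b
    to be the group inverse of a ([antipodal_rigid]). So f v is a Dirac mass.

    In general f 0 is only at finite distance from the Dirac mass at the
    origin, which becomes negligible compared with |v| when v is large. The
    equality case is therefore replaced by the stability estimate
    [antipodal_defect], obtained from it by compactness and homogeneity;
    integrated against the product coupling it shows that f (t v) is within
    o(t) of a Dirac mass when |v| = 1 ([almost_dirac]). Shrinking by the
    dilation of factor 1 / t, the 2k vectors e_i, - e_i of R^k yield points of
    H^n whose mutual distances are as close as desired to those of the
    vectors, and the point of - e_i may be taken to be the group inverse of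
    that of e_i ([embedding_frame]).

    The fourth power of the distance is polynomial in the coordinates. Read in
    the limit, these distances say that the vertical coordinates vanish, that
    the horizontal parts are orthonormal, and that the symplectic form
    vanishes on them ([frame_gram_limit]). The horizontal parts together with
    their images under the complex structure thus form an almost orthonormal
    family of 2k vectors in R^(2n), so that k <= n
    ([almost_isotropic_dim]). *)

Set Implicit Arguments.
Unset Strict Implicit.
Unset Printing Implicit Defensive.

Import Order.TTheory GRing.Theory Num.Theory.
Import numFieldNormedType.Exports.

Local Open Scope classical_set_scope.
Local Open Scope ring_scope.

(** * Planar vectors and strict convexity of powers *)

Section Plane.
Context {R : realType}.

Lemma dot2_le (x y z w r s : R) : 0 <= r -> 0 <= s ->
  x ^+ 2 + y ^+ 2 <= r ^+ 2 -> z ^+ 2 + w ^+ 2 <= s ^+ 2 ->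
  x * z + y * w <= r * s.
Proof.
move=> r0 s0 xy zw; apply: le_trans (ler_norm _) _.
rewrite -ler_sqr ?nnegrE ?mulr_ge0// real_normK ?num_real//.
have h : 0 <= (x * w - y * z) ^+ 2 by exact: sqr_ge0.
have : (x ^+ 2 + y ^+ 2) * (z ^+ 2 + w ^+ 2) <= r ^+ 2 * s ^+ 2.
  by apply: ler_pM => //; rewrite addr_ge0 ?sqr_ge0.
by nra.
Qed.

Lemma norm_sum3_le (x1 y1 x2 y2 x3 y3 r1 r2 r3 : R) :
  0 <= r1 -> 0 <= r2 -> 0 <= r3 ->
  x1 ^+ 2 + y1 ^+ 2 <= r1 ^+ 2 -> x2 ^+ 2 + y2 ^+ 2 <= r2 ^+ 2 ->
  x3 ^+ 2 + y3 ^+ 2 <= r3 ^+ 2 ->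
  (x1 + x2 + x3) ^+ 2 + (y1 + y2 + y3) ^+ 2 <= (r1 + r2 + r3) ^+ 2.
Proof.
move=> p1 p2 p3 h1 h2 h3.
have := dot2_le p1 p2 h1 h2; have := dot2_le p1 p3 h1 h3.
have := dot2_le p2 p3 h2 h3; lra.
Qed.

Lemma powR_predE (p x : R) : 1 < p -> 0 <= x -> x `^ p = x `^ (p - 1) * x.
Proof.
move=> p1; rewrite le_eqVlt => /predU1P[<-|x0].
  by rewrite powR0 ?mulr0// gt_eqF//; lra.
rewrite -[X in _ * X]powRr1 ?ltW// -powRD ?subrK//.
by rewrite (gt_eqF x0) implybT.
Qed.

(** The strict tangent inequality at 1, applied to a / m and b / m where m is
    the midpoint, and summed: the linear parts cancel. *)
Lemma powR_midpoint_lt (p a b : R) : 1 < p -> 0 <= a -> 0 <= b -> a != b ->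
  (a + b) `^ p < 2 `^ (p - 1) * (a `^ p + b `^ p).
Proof.
(* With u = ln x, the claim is e^u * e^((p-1)u) > 1 + p (e^u - 1); bounding
   the second exponential by its tangent leaves e^(-u) > 1 - u. *)
have tangent (x : R) : 1 < p -> 0 <= x -> x != 1 -> 1 + p * (x - 1) < x `^ p.
  move=> p1; rewrite le_eqVlt => /predU1P[<- _|x0 x1].
    by rewrite powR0 ?gt_eqF//; lra.
  have lx0 : - ln x != 0 by rewrite oppr_eq0 ln_eq0.
  have := expR_gt1Dx lx0; rewrite expRN lnK ?posrE// => h1.
  have h2 := expR_ge1Dx ((p - 1) * ln x).
  rewrite -[X in expR X]ln_powR lnK ?posrE ?powR_gt0// in h2.
  rewrite (powR_predE p1 (ltW x0)) [X in _ < X]mulrC.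
  apply: lt_le_trans (_ : x * (1 + (p - 1) * ln x) <= _); last by rewrite ler_pM2l.
  rewrite -(ltr_pM2l x0) mulfV ?gt_eqF// in h1; nra.
move=> p1 a0 b0 ab; pose m := (a + b) / 2.
have p0 : p != 0 by rewrite gt_eqF//; lra.
have m0 : 0 < m.
  by move: ab; rewrite neq_lt /m => /orP[] ?; lra.
have aE : a = m * (a / m) by field; rewrite gt_eqF.
have bE : b = m * (b / m) by field; rewrite gt_eqF.
have abm : a / m + b / m = 2 by rewrite /m; field; rewrite -/(a+b); move: m0; rewrite /m gt_eqF//; lra.
have an1 : a / m != 1.
  apply: contra ab => /eqP e; apply/eqP; rewrite aE bE; congr (_ * _); lra.
have bn1 : b / m != 1.
  apply: contra ab => /eqP e; apply/eqP; rewrite aE bE; congr (_ * _); lra.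
have ha := tangent _ p1 (divr_ge0 a0 (ltW m0)) an1.
have hb := tangent _ p1 (divr_ge0 b0 (ltW m0)) bn1.
have -> : a + b = m * 2 by rewrite /m; field.
clearbody m.
have := divr_ge0 b0 (ltW m0); have := divr_ge0 a0 (ltW m0).
move: aE bE abm ha hb {an1 bn1}; move: (a / m) (b / m) => u v aE bE uv ha hb u0 v0.
rewrite aE bE !powRM// ?(ltW m0)// -mulrDr [X in _ < X]mulrCA.
rewrite ltr_pM2l ?powR_gt0//.
rewrite (powR_predE p1 (ler0n _ 2)).
rewrite ltr_pM2l ?powR_gt0//; nra.
Qed.

Lemma powR_midpoint_le (p a b : R) : 1 < p -> 0 <= a -> 0 <= b ->
  (a + b) `^ p <= 2 `^ (p - 1) * (a `^ p + b `^ p).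
Proof.
move=> p1 a0 b0; have [<-|ab] := eqVneq a b; last exact/ltW/powR_midpoint_lt.
rewrite (_ : a + a = 2 * a) ?powRM// ?(powR_predE p1 (ler0n _ 2)); lra.
Qed.

End Plane.

(** * The Koranyi metric *)

Section KoranyiMetric.
Context {R : realType} {n : nat}.
Implicit Types a b c : heisenberg R n.

(** [hdot] and [hsym] are, up to sign conventions, the real and imaginary parts
    of the Hermitian product of the horizontal parts x + iy in C^n. *)
Definition hdot a b : R :=
  \sum_(i < n) (a.1.1 ord0 i * b.1.1 ord0 i + a.1.2 ord0 i * b.1.2 ord0 i).

Definition hsym a b : R :=
  \sum_(i < n) (b.1.1 ord0 i * a.1.2 ord0 i - a.1.1 ord0 i * b.1.2 ord0 i).

Lemma hdot_ge0 a : 0 <= hdot a a.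
Proof. by apply: sumr_ge0 => i _; rewrite -!expr2 addr_ge0 ?sqr_ge0. Qed.

Lemma koranyi_ge0 a : 0 <= koranyi_norm a.
Proof. exact: powR_ge0. Qed.

Lemma koranyi_exp4 a : koranyi_norm a ^+ 4 = hdot a a ^+ 2 + a.2 ^+ 2.
Proof.
rewrite /koranyi_norm -powR_mulrn ?powR_ge0// -powRrM mulVf ?pnatr_eq0// powRr1.
  by congr (_ ^+ 2 + _); apply: eq_bigr => i _; rewrite !expr2.
by rewrite addr_ge0 ?sqr_ge0.
Qed.

(** The modulus form of the Cauchy-Schwarz inequality in C^n; bounding the real
    part alone would not control the vertical coordinate of a product. *)
Lemma hermitian_cauchy_schwarz a b :
  hdot a b ^+ 2 + hsym a b ^+ 2 <= hdot a a * hdot b b.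
Proof.
have sumE P Q B : \sum_(i < n)
   ((B * a.1.1 ord0 i - (P * b.1.1 ord0 i - Q * b.1.2 ord0 i)) ^+ 2
  + (B * a.1.2 ord0 i - (P * b.1.2 ord0 i + Q * b.1.1 ord0 i)) ^+ 2)
  = B ^+ 2 * hdot a a - 2 * B * P * hdot a b - 2 * B * Q * hsym a b
     + (P ^+ 2 + Q ^+ 2) * hdot b b.
  rewrite !mulr_sumr -!sumrB -big_split/=.
  by apply: eq_bigr => i _; ring.
set P := hdot a b; set Q := hsym a b; set A := hdot a a; set B := hdot b b.
have [B0|B0] := eqVneq B 0.
  have bi i : b.1.1 ord0 i = 0 /\ b.1.2 ord0 i = 0.
    have := B0; rewrite /B /hdot; move=> /eqP.
    rewrite psumr_eq0 => [/allP/(_ i (mem_index_enum i))/=|j _]; last first.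
      by rewrite -!expr2 addr_ge0 ?sqr_ge0.
    rewrite -!expr2 paddr_eq0 ?sqr_ge0// !sqrf_eq0 => /andP[/eqP-> /eqP->]//.
  have -> : P = 0.
    by apply: big1 => i _; have [-> ->] := bi i; rewrite !mulr0 addr0.
  have -> : Q = 0.
    by apply: big1 => i _; have [-> ->] := bi i; rewrite mul0r mulr0 subr0.
  by rewrite B0 expr0n/= addr0 mulr0.
have B_gt0 : 0 < B by rewrite lt_neqAle eq_sym B0 hdot_ge0.
(* Squared norm of |b|^2 a - <a, b> b, for the complex inner product. *)
have : 0 <= \sum_(i < n)
   ((B * a.1.1 ord0 i - (P * b.1.1 ord0 i - Q * b.1.2 ord0 i)) ^+ 2
  + (B * a.1.2 ord0 i - (P * b.1.2 ord0 i + Q * b.1.1 ord0 i)) ^+ 2).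
  by apply: sumr_ge0 => i _; rewrite addr_ge0 ?sqr_ge0.
rewrite sumE -/A -/B -/P -/Q.
move=> h; rewrite -(ler_pM2l B_gt0); nra.
Qed.

Lemma hdot_mul a b : hdot (heis_mul a b) (heis_mul a b) =
  hdot a a + hdot b b + 2 * hdot a b.
Proof.
rewrite /hdot mulr_sumr -!big_split/=; apply: eq_bigr => i _.
by rewrite !mxE; ring.
Qed.

Lemma heis_mul2 a b : (heis_mul a b).2 = a.2 + b.2 + 2 * hsym a b.
Proof. by []. Qed.

(** The square of the norm is the modulus of |x + iy|^2 + i z. For a product
    this complex number is the sum of those of a and b and of twice the
    Hermitian product, whose modulus is at most |a| |b|. *)
Lemma koranyi_triangle a b :
  koranyi_norm (heis_mul a b) <= koranyi_norm a + koranyi_norm b.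
Proof.
have a0 := koranyi_ge0 a; have b0 := koranyi_ge0 b.
rewrite -(@ler_pXn2r _ 4)// ?nnegrE ?addr_ge0 ?koranyi_ge0//.
rewrite koranyi_exp4 hdot_mul heis_mul2.
have -> : (koranyi_norm a + koranyi_norm b) ^+ 4 =
  (koranyi_norm a ^+ 2 + koranyi_norm b ^+ 2
     + 2 * (koranyi_norm a * koranyi_norm b)) ^+ 2 by ring.
apply: norm_sum3_le; rewrite ?mulr_ge0 ?sqr_ge0//.
- by rewrite -exprM koranyi_exp4.
- by rewrite -exprM koranyi_exp4.
have := hermitian_cauchy_schwarz a b.
have haN : hdot a a <= koranyi_norm a ^+ 2.
  rewrite -ler_sqr ?nnegrE ?sqr_ge0 ?hdot_ge0// -exprM koranyi_exp4.
  by rewrite lerDl sqr_ge0.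
have hbN : hdot b b <= koranyi_norm b ^+ 2.
  rewrite -ler_sqr ?nnegrE ?sqr_ge0 ?hdot_ge0// -exprM koranyi_exp4.
  by rewrite lerDl sqr_ge0.
have := ler_pM (hdot_ge0 a) (hdot_ge0 b) haN hbN.
rewrite !exprMn; lra.
Qed.

Lemma heis_dist_ge0 a b : 0 <= heis_dist a b.
Proof. exact: koranyi_ge0. Qed.

Lemma hdotC a b : hdot a b = hdot b a.
Proof. by apply: eq_bigr => i _; ring. Qed.

Lemma hsymC a b : hsym a b = - hsym b a.
Proof. by rewrite -sumrN; apply: eq_bigr => i _; ring. Qed.

Lemma hdot_opp a b : hdot a (heis_opp b) = - hdot a b.
Proof. by rewrite -sumrN; apply: eq_bigr => i _; rewrite !mxE; ring. Qed.

Lemma hsym_opp a b : hsym a (heis_opp b) = - hsym a b.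
Proof. by rewrite -sumrN; apply: eq_bigr => i _; rewrite !mxE; ring. Qed.

Lemma heis_dist_exp4 a b : heis_dist a b ^+ 4 =
  (hdot a a + hdot b b - 2 * hdot a b) ^+ 2 + (b.2 - a.2 - 2 * hsym a b) ^+ 2.
Proof.
rewrite /heis_dist koranyi_exp4 hdot_mul heis_mul2.
rewrite hdot_opp (hdotC (heis_opp a) a) hdot_opp (hdotC (heis_opp a) b).
rewrite hdot_opp (hsymC (heis_opp a) b) hsym_opp (hdotC b a) (hsymC b a).
by rewrite /=; ring.
Qed.

Lemma heis_dist_inj4 a b c d : heis_dist a b ^+ 4 = heis_dist c d ^+ 4 ->
  heis_dist a b = heis_dist c d.
Proof.
by move=> /eqP; rewrite eqrXn2 ?heis_dist_ge0// => /eqP.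
Qed.

Lemma heis_distC a b : heis_dist a b = heis_dist b a.
Proof.
apply: heis_dist_inj4; rewrite !heis_dist_exp4 (hdotC b) (hsymC b); ring.
Qed.

Lemma heis_distxx a : heis_dist a a = 0.
Proof.
have hs : hsym a a = 0 by apply: big1 => i _; ring.
have /eqP := heis_dist_exp4 a a.
rewrite hs [X in _ == X](_ : _ = 0); last by ring.
by rewrite expf_eq0 => /andP[_ /eqP].
Qed.

Lemma heis_mul_telescope a b c :
  heis_mul (heis_opp a) c =
  heis_mul (heis_mul (heis_opp a) b) (heis_mul (heis_opp b) c).
Proof.
rewrite /heis_mul /heis_opp /=; congr (_, _, _).
- by rewrite addrA addrK.
- by rewrite addrA addrK.
set S1 := (X in _ + 2 * X = _); set S2 := (X in _ = _ + 2 * X + _ + _).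
set S3 := (X in _ = _ + (_ + 2 * X) + _); set S4 := (X in _ = _ + 2 * X).
have -> : S1 = S2 + S3 + S4; last by ring.
rewrite /S1 /S2 /S3 /S4 -!big_split/=; apply: eq_bigr => i _.
by rewrite !mxE; ring.
Qed.

Lemma heis_dist_triangle a b c :
  heis_dist a c <= heis_dist a b + heis_dist b c.
Proof. by rewrite /heis_dist (heis_mul_telescope a b c) koranyi_triangle. Qed.

End KoranyiMetric.

Section HeisGeometry.
Context {R : realType} {n : nat}.
Implicit Types a b c : heisenberg R n.

Definition heis0 : heisenberg R n := (0, 0, 0).

Lemma hdot0 a : hdot heis0 a = 0.
Proof. by apply: big1 => i _; rewrite !mxE; ring. Qed.

Lemma heis_dist0 a : heis_dist heis0 a = koranyi_norm a.
Proof.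
apply/eqP; rewrite -(@eqrXn2 _ 4) ?koranyi_ge0//.
rewrite heis_dist_exp4 koranyi_exp4 !hdot0 /= [hsym _ _]big1.
  by apply/eqP; ring.
by move=> i _; rewrite !mxE; ring.
Qed.

Lemma koranyi_opp a : koranyi_norm (heis_opp a) = koranyi_norm a.
Proof.
apply/eqP; rewrite -(@eqrXn2 _ 4) ?koranyi_ge0// !koranyi_exp4.
by rewrite hdot_opp hdotC hdot_opp opprK sqrrN.
Qed.

Lemma koranyi_dist_le a b : heis_dist a b <= koranyi_norm a + koranyi_norm b.
Proof.
have := heis_dist_triangle a heis0 b.
by rewrite (heis_distC a heis0) !heis_dist0.
Qed.

Definition heis_dil (r : R) a : heisenberg R n :=
  (r *: a.1.1, r *: a.1.2, r ^+ 2 * a.2).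

Lemma hdot_dil r a b : hdot (heis_dil r a) (heis_dil r b) = r ^+ 2 * hdot a b.
Proof. by rewrite mulr_sumr; apply: eq_bigr => i _; rewrite !mxE; ring. Qed.

Lemma hsym_dil r a b : hsym (heis_dil r a) (heis_dil r b) = r ^+ 2 * hsym a b.
Proof. by rewrite mulr_sumr; apply: eq_bigr => i _; rewrite !mxE; ring. Qed.

Lemma heis_opp_dil r a : heis_opp (heis_dil r a) = heis_dil r (heis_opp a).
Proof. by rewrite /heis_opp /heis_dil /= !scalerN mulrN. Qed.

Lemma heis_dist_dil r a b : 0 <= r ->
  heis_dist (heis_dil r a) (heis_dil r b) = r * heis_dist a b.
Proof.
move=> r0; apply/eqP; rewrite -(@eqrXn2 _ 4) ?mulr_ge0 ?koranyi_ge0//.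
rewrite exprMn !heis_dist_exp4 !hdot_dil hsym_dil /=; apply/eqP; ring.
Qed.

Lemma koranyi_dil r a : 0 <= r ->
  koranyi_norm (heis_dil r a) = r * koranyi_norm a.
Proof.
move=> r0; have := heis_dist_dil heis0 a r0.
have -> : heis_dil r heis0 = heis0 by rewrite /heis_dil /= !scaler0 mulr0.
by rewrite !heis_dist0.
Qed.

Lemma hdot_le_koranyi a : hdot a a <= koranyi_norm a ^+ 2.
Proof.
rewrite -ler_sqr ?nnegrE ?sqr_ge0 ?hdot_ge0// -exprM koranyi_exp4.
by rewrite lerDl sqr_ge0.
Qed.

(** The projection onto the horizontal part is 1-Lipschitz. *)
Lemma horizontal_dist_le a b :
  hdot a a + hdot b b - 2 * hdot a b <= heis_dist a b ^+ 2.
Proof.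
have := hdot_le_koranyi (heis_mul (heis_opp a) b).
rewrite hdot_mul hdot_opp (hdotC (heis_opp a) a) hdot_opp.
by rewrite (hdotC (heis_opp a) b) hdot_opp (hdotC b a) -/(heis_dist a b); lra.
Qed.

Lemma coord_dist_le a b i :
  `|a.1.1 ord0 i - b.1.1 ord0 i| <= heis_dist a b /\
  `|a.1.2 ord0 i - b.1.2 ord0 i| <= heis_dist a b.
Proof.
suff h : (a.1.1 ord0 i - b.1.1 ord0 i) ^+ 2
     + (a.1.2 ord0 i - b.1.2 ord0 i) ^+ 2 <= heis_dist a b ^+ 2.
  by split; rewrite -ler_sqr ?nnegrE ?koranyi_ge0// real_normK ?num_real//;
    apply: le_trans h; rewrite ?lerDl ?lerDr sqr_ge0.
apply: le_trans (horizontal_dist_le a b).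
rewrite /hdot mulr_sumr -big_split -sumrB/= (bigD1 i)//=.
rewrite -[X in X <= _]addr0 lerD//; first by lra.
apply: sumr_ge0 => j _.
have := sqr_ge0 (a.1.1 ord0 j - b.1.1 ord0 j).
have := sqr_ge0 (a.1.2 ord0 j - b.1.2 ord0 j); lra.
Qed.

(** The vertical coordinate is only locally uniformly continuous, because the
    group law twists it by the symplectic form; this is enough to make it
    Borel. *)
Lemma vert_dist_le a b : `|a.2 - b.2| <=
  heis_dist a b ^+ 2 + 2 * (koranyi_norm a * heis_dist a b).
Proof.
have hs : `|hsym a b| <= koranyi_norm a * heis_dist a b.
  have -> : hsym a b = hsym a (heis_mul (heis_opp a) b).
    by apply: eq_bigr => i _; rewrite !mxE; ring.
  rewrite -ler_sqr ?nnegrE ?mulr_ge0 ?koranyi_ge0// real_normK ?num_real//.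
  have := hermitian_cauchy_schwarz a (heis_mul (heis_opp a) b).
  have := ler_pM (hdot_ge0 a) (hdot_ge0 _) (hdot_le_koranyi a)
    (hdot_le_koranyi (heis_mul (heis_opp a) b)).
  have := sqr_ge0 (hdot a (heis_mul (heis_opp a) b)).
  rewrite exprMn -/(heis_dist a b); lra.
have hv : `|b.2 - a.2 - 2 * hsym a b| <= heis_dist a b ^+ 2.
  rewrite -ler_sqr ?nnegrE ?sqr_ge0// real_normK ?num_real// -exprM.
  by rewrite heis_dist_exp4 lerDr sqr_ge0.
move: hs hv; rewrite !ler_norml => /andP[h1 h2] /andP[h3 h4].
by apply/andP; split; lra.
Qed.

(** The equality case of the triangle inequality through the origin, at equal
    norms. The three planar vectors in the proof of that inequality must be
    parallel and of maximal length, so both points are horizontal and their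
    horizontal parts are opposite. The conclusion is stated as a vanishing
    distance since this is the quantity integrated later. *)
Lemma antipodal_rigid a b : koranyi_norm a = koranyi_norm b ->
  heis_dist a b = koranyi_norm a + koranyi_norm b ->
  heis_dist a (heis_opp b) = 0.
Proof.
move=> ab dab.
have r0 := koranyi_ge0 a.
have ka := koranyi_exp4 a; have kb := koranyi_exp4 b.
have kd := heis_dist_exp4 a b.
have A0 := hdot_ge0 a; have B0 := hdot_ge0 b.
have := hermitian_cauchy_schwarz a b.
have := hdot_le_koranyi a; have := hdot_le_koranyi b.
move: ka kb kd; rewrite dab -ab.
set N := koranyi_norm a in r0 *; move: A0 B0.
set A := hdot a a; set B := hdot b b; set P := hdot a b; set Q := hsym a b.
have -> : N ^+ 4 = (N ^+ 2) ^+ 2 by ring.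
have -> : (N + N) ^+ 4 = 16 * (N ^+ 2) ^+ 2 by ring.
have : 0 <= N ^+ 2 by exact: sqr_ge0.
move: (N ^+ 2) => S S0 A0 B0 ka kb kd BS AS CS.
have AB : A * B <= S ^+ 2 by rewrite expr2 ler_pM.
have uv : A * B + (- a.2) * b.2 <= S * S.
  by apply: dot2_le => //; rewrite ?sqrrN -?ka -?kb.
have uw : A * (- 2 * P) + (- a.2) * (- 2 * Q) <= S * (2 * S).
  by apply: dot2_le => //; rewrite ?sqrrN -?ka ?mulr_ge0//; nra.
have vw : B * (- 2 * P) + b.2 * (- 2 * Q) <= S * (2 * S).
  by apply: dot2_le => //; rewrite ?sqrrN -?kb ?mulr_ge0//; nra.
have ABS : A * B = S ^+ 2 by nra.
have AE : A = S by apply/eqP; rewrite eq_le AS /=; nra.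
have BE : B = S by apply/eqP; rewrite eq_le BS /=; nra.
have ta : a.2 = 0 by apply/eqP; rewrite -sqrf_eq0; apply/eqP; move: ka; rewrite AE; lra.
have tb : b.2 = 0 by apply/eqP; rewrite -sqrf_eq0; apply/eqP; move: kb; rewrite BE; lra.
have PE : P = - S.
  rewrite AE BE ta tb in uw vw kd CS.
  apply/eqP; rewrite eq_le; apply/andP; split; nra.
have QE : Q = 0.
  apply/eqP; rewrite -sqrf_eq0; apply/eqP.
  have := sqr_ge0 Q; rewrite PE AE BE in CS; nra.
apply/eqP; have := heis_dist_exp4 a (heis_opp b).
rewrite !hdot_opp (hdotC (heis_opp b) b) !hdot_opp hsym_opp /=.
rewrite -/A -/B -/P -/Q ta tb PE QE AE BE => h.
have /eqP : heis_dist a (heis_opp b) ^+ 4 = 0 by rewrite h; ring.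
by rewrite expf_eq0.
Qed.

End HeisGeometry.

(** * Stability of the antipodal rigidity *)

Section Stability.
Context {R : realType}.

(** The absolute value is there because [powR] is 1 on negative reals, hence
    discontinuous at 0. *)
Lemma continuous_norm_powR (p : R) : 0 < p -> continuous (fun x : R => `|x| `^ p).
Proof.
move=> p0 x; have [->|x0] := eqVneq x 0.
  rewrite /continuous_at normr0 powR0 ?gt_eqF//.
  apply/cvgr0Pnorm_lt => e e0; near=> y.
  rewrite ger0_norm ?powR_ge0//.
  have -> : e = (e `^ p^-1) `^ p by rewrite -powRrM mulVf ?gt_eqF// powRr1// ltW.
  apply: gt0_ltr_powR => //; rewrite ?nnegrE ?powR_ge0//.
  by near: y; apply: (@cvgr0_norm_lt _ _ _ (nbhs (0:R)) _ id) => //; exact: powR_gt0.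
have h : {for x, continuous (fun x : R => expR (p * ln `|x|))}.
  apply: continuous_comp; last exact: continuous_expR.
  apply: continuousM; first exact: cvg_cst.
  apply: continuous_comp; first exact: norm_continuous.
  by apply: continuous_ln; rewrite normr_gt0.
rewrite /continuous_at in h *.
rewrite [X in _ --> X](_ : _ = expR (p * ln `|x|)); last first.
  by rewrite /powR normr_eq0 (negbTE x0).
apply: cvg_trans h; apply: near_eq_cvg; near=> y.
have y0 : y != 0 by near: y; exact: (cvgr_neq0 x (@cvg_id _ _) x0).
by rewrite /powR normr_eq0 (negbTE y0).
Unshelve. all: by end_near. Qed.

Section Point.
Context (n : nat).
Let X := ('rV[R]_n * 'rV[R]_n * R)%type.

Lemma first_point_continuous : continuous (fun z : X * X => z.1).
Proof. by move=> z; exact: cvg_fst. Qed.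
Lemma second_point_continuous : continuous (fun z : X * X => z.2).
Proof. by move=> z; exact: cvg_snd. Qed.

Lemma coord1_continuous i : continuous (fun x : X => x.1.1 ord0 i).
Proof.
move=> x; apply: (@continuous_comp _ _ _ (fun x : X => x.1.1) (fun v => v ord0 i)).
  by apply: (@continuous_comp _ _ _ (fun x : X => x.1) fst); exact: cvg_fst.
exact: coord_continuous.
Qed.

Lemma coord2_continuous i : continuous (fun x : X => x.1.2 ord0 i).
Proof.
move=> x; apply: (@continuous_comp _ _ _ (fun x : X => x.1.2) (fun v => v ord0 i)).
  by apply: (@continuous_comp _ _ _ (fun x : X => x.1) snd); [exact: cvg_fst|exact: cvg_snd].
exact: coord_continuous.
Qed.

Lemma bilinear_continuous (U : topologicalType) (f g : U -> X) :
  continuous f -> continuous g ->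
  continuous (fun z => hdot (f z) (g z)) /\
  continuous (fun z => hsym (f z) (g z)).
Proof.
move=> cf cg.
have c1 (h : U -> X) i : continuous h -> continuous (fun z => (h z).1.1 ord0 i).
  by move=> ch x; apply: (@continuous_comp _ _ _ h (fun a : X => a.1.1 ord0 i)); [exact: ch|exact: coord1_continuous].
have c2 (h : U -> X) i : continuous h -> continuous (fun z => (h z).1.2 ord0 i).
  by move=> ch x; apply: (@continuous_comp _ _ _ h (fun a : X => a.1.2 ord0 i)); [exact: ch|exact: coord2_continuous].
split; apply: continuous_big => [|i _ x].
- exact: add_continuous.
- by apply: cvgD; apply: cvgM; (try exact: c1); exact: c2.
- exact: add_continuous.
- by apply: cvgB; apply: cvgM; (try exact: c1); exact: c2.
Qed.

Lemma heis_dist_continuous (U : topologicalType) (f g : U -> X) :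
  continuous f -> continuous g ->
  continuous (fun z => heis_dist (f z) (g z) : R).
Proof.
move=> cf cg.
have -> : (fun z => heis_dist (f z) (g z) : R) = fun z => Num.sqrt (Num.sqrt
   ((hdot (f z) (f z) + hdot (g z) (g z) - 2 * hdot (f z) (g z)) ^+ 2 +
   ((g z).2 - (f z).2 - 2 * hsym (f z) (g z)) ^+ 2)).
  apply/funext => z; rewrite -heis_dist_exp4.
  rewrite (exprM _ 2 2) sqrtr_sqr ger0_norm ?sqr_ge0//.
  by rewrite sqrtr_sqr ger0_norm// koranyi_ge0.
have [c1 _] := bilinear_continuous cf cf.
have [c2 _] := bilinear_continuous cg cg.
have [c3 c4] := bilinear_continuous cf cg.
have snd_f (h : U -> X) : continuous h -> continuous (fun z => (h z).2).
  by move=> ch z; apply: (@continuous_comp _ _ _ h snd); [exact: ch|exact: cvg_snd].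
have h1 : continuous (fun z => hdot (f z) (f z) + hdot (g z) (g z) - 2 * hdot (f z) (g z)).
  move=> x; apply: cvgB; first by apply: cvgD; [exact: c1|exact: c2].
  by apply: cvgM; [exact: cvg_cst|exact: c3].
have h2 : continuous (fun z => (g z).2 - (f z).2 - 2 * hsym (f z) (g z)).
  move=> x; apply: cvgB; last by apply: cvgM; [exact: cvg_cst|exact: c4].
  by apply: cvgB; [exact: (snd_f g)|exact: (snd_f f)].
move=> x.
apply: continuous_comp; last exact: sqrt_continuous.
apply: continuous_comp; last exact: sqrt_continuous.
apply: cvgD; first by apply: cvgM; exact: h1.
by apply: cvgM; exact: h2.
Qed.

Lemma heis_opp_continuous (U : topologicalType) (f : U -> X) : continuous f ->
  continuous (fun z => heis_opp (f z) : X).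
Proof.
move=> cf; rewrite /heis_opp.
have cN (V : normedModType R) (h : U -> V) : continuous h -> continuous (fun z => - h z).
  by move=> ch z; apply: (@continuous_comp _ _ _ h -%R); [exact: ch|exact: opp_continuous].
have cP (V W : topologicalType) (h : U -> V) (k : U -> W) :
    continuous h -> continuous k -> continuous (fun z => (h z, k z)).
  by move=> ch ck z; apply: cvg_pair; [exact: ch|exact: ck].
have c1 : continuous (fun z => (f z).1).
  by move=> z; apply: (@continuous_comp _ _ _ f fst); [exact: cf|exact: cvg_fst].
have c2 : continuous (fun z => (f z).2).
  by move=> z; apply: (@continuous_comp _ _ _ f snd); [exact: cf|exact: cvg_snd].
have c11 : continuous (fun z => (f z).1.1).
  by move=> z; apply: (@continuous_comp _ _ _ (fun z => (f z).1) fst); [exact: c1|exact: cvg_fst].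
have c12 : continuous (fun z => (f z).1.2).
  by move=> z; apply: (@continuous_comp _ _ _ (fun z => (f z).1) snd); [exact: c1|exact: cvg_snd].
by apply/cP; [apply/cP|]; exact/cN.
Qed.

Definition unit_box : set X :=
  ([set v : 'rV[R]_n | forall i, `[-1, 1]%classic (v ord0 i)] `*`
  [set v : 'rV[R]_n | forall i, `[-1, 1]%classic (v ord0 i)]) `*` `[-1, 1]%classic.

Lemma compact_unit_box : compact unit_box.
Proof.
have crow : compact [set v : 'rV[R]_n | forall i, `[-1, 1]%classic (v ord0 i)].
  by apply: (@rV_compact R n (fun=> `[-1, 1]%classic)) => i; exact: segment_compact.
have cpair := compact_setX crow crow.
exact: (compact_setX cpair (@segment_compact _ _ _)).
Qed.

Lemma koranyi_ball_sub_box (a : X) : koranyi_norm (a : heisenberg R n) <= 1 -> unit_box a.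
Proof.
move=> a1.
have ci (i : 'I_n) := coord_dist_le (@heis0 R n) a i.
have := koranyi_exp4 (a : heisenberg R n).
have := koranyi_ge0 (a : heisenberg R n).
have k4 : koranyi_norm (a : heisenberg R n) ^+ 4 <= 1.
  by rewrite exprn_ile1// koranyi_ge0.
rewrite !heis_dist0 in ci => k0 k4E.
split; [split|] => /=.
- move=> i; rewrite in_itv/= -ler_norml; apply: le_trans a1.
  by have [] := ci i; rewrite !mxE sub0r normrN.
- move=> i; rewrite in_itv/= -ler_norml; apply: le_trans a1.
  by have [_] := ci i; rewrite !mxE sub0r normrN.
rewrite in_itv/= -ler_norml -(@expr_le1 _ 2)// real_normK ?num_real//.
by apply: le_trans k4; rewrite k4E lerDr sqr_ge0.
Qed.

End Point.

(** Where f < eta the claim is clear; on the compact set where f >= eta the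
    function g is positive, hence bounded below, while f is bounded above. *)
Lemma compact_domination (T : topologicalType) (K : set T) (f g : T -> R)
  (eta : R) : compact K -> continuous f -> continuous g -> 0 < eta ->
  (forall x, K x -> 0 <= g x) -> (forall x, K x -> g x = 0 -> f x = 0) ->
  exists2 C, 0 <= C & forall x, K x -> f x <= eta + C * g x.
Proof.
move=> cK cf cg eta0 g0 gf.
pose K' := K `&` [set x | eta <= f x].
have cK' : compact K'.
  apply: compact_closedI => //.
  by move/continuous_closedP: cf => /(_ _ (@closed_ge R eta)).
have [K'0|/set0P/negP] := pselect (K' !=set0); last first.
  rewrite negbK => /eqP K'0; exists 0 => // x Kx; rewrite mul0r addr0.
  apply: ltW; rewrite ltNge; apply/negP => fx.
  by have : K' x by []; rewrite K'0.
have [y /set_mem[Ky /= fy] ymin] := compact_EVT_min K'0 cK' (continuous_subspaceT cg).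
have [z /set_mem[Kz /= fz] zmax] := compact_EVT_max K'0 cK' (continuous_subspaceT cf).
have gy : 0 < g y.
  rewrite lt_neqAle g0// andbT; apply/negP => /eqP gy.
  by move: fy; rewrite (gf y)// leNgt eta0.
have fz0 : 0 <= f z by exact: le_trans (ltW eta0) fz.
exists (f z / g y) => [|x Kx]; first by rewrite divr_ge0// ltW.
have [fx|fx] := ltP (f x) eta.
  by apply: (le_trans (ltW fx)); rewrite lerDl mulr_ge0 ?g0// divr_ge0// ltW.
have K'x : x \in K' by apply: mem_set; split.
apply: le_trans (zmax x K'x) _; rewrite -[X in X <= _]add0r; apply: lerD; first exact: ltW.
rewrite -[X in X <= _](divfK (lt0r_neq0 gy)).
by rewrite ler_pM// ?divr_ge0 ?(ltW gy)// ymin.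
Qed.

#[local] Opaque koranyi_norm heis_dist.

(** By convexity and the triangle inequality,
    2^(p-1) (|a|^p + |b|^p) - (d a b)^p is nonnegative, and by strict convexity
    and [antipodal_rigid] it vanishes only when b is the inverse of a. On the
    compact set |a|^p + |b|^p = 1 it therefore controls (d a b^-1)^p up to eta,
    and both sides scale by r^p under the dilation of factor r. Writing the
    bound without subtraction makes it ready for integration. *)
Lemma antipodal_defect n (p eta : R) : 1 < p -> 0 < eta ->
  exists2 C, 0 <= C & forall a b : heisenberg R n,
    heis_dist a (heis_opp b) `^ p + C * heis_dist a b `^ p <=
    (eta + C * 2 `^ (p - 1)) * (koranyi_norm a `^ p + koranyi_norm b `^ p).
Proof.
move=> p1 eta0.
have p0 : 0 < p by lra.
pose X := ('rV[R]_n * 'rV[R]_n * R)%type.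
pose S (z : X * X) : R := `|heis_dist (heis0 : X) z.1| `^ p + `|heis_dist (heis0 : X) z.2| `^ p.
pose f (z : X * X) : R := `|heis_dist z.1 (heis_opp z.2)| `^ p.
pose g (z : X * X) : R := 2 `^ (p - 1) * S z - `|heis_dist z.1 z.2| `^ p.
have dc (u v : X * X -> X) : continuous u -> continuous v ->
    continuous (fun z => `|heis_dist (u z) (v z) : R| `^ p).
  move=> cu cv z; apply: (@continuous_comp _ _ _ (fun z => heis_dist (u z) (v z) : R) (fun x => `|x| `^ p)).
    exact: heis_dist_continuous.
  exact: continuous_norm_powR.
have c0 : continuous (fun _ : X * X => heis0 : X) by move=> z; exact: cvg_cst.
have cS : continuous S.
  by move=> z; apply: cvgD; apply: dc => //; [exact: first_point_continuous|exact: second_point_continuous].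
have cf : continuous f.
  by apply: dc; [exact: first_point_continuous|apply: heis_opp_continuous; exact: second_point_continuous].
have cg : continuous g.
  move=> z; apply: cvgB; last by apply: dc; [exact: first_point_continuous|exact: second_point_continuous].
  by apply: cvgM; [exact: cvg_cst|exact: cS].
have nd (a b : X) : `|heis_dist a b : R| = heis_dist a b.
  by rewrite ger0_norm// heis_dist_ge0.
have SE z : S z = koranyi_norm z.1 `^ p + koranyi_norm z.2 `^ p.
  by rewrite /S !nd !heis_dist0.
have dle (z : X * X) : heis_dist z.1 z.2 `^ p <= (koranyi_norm z.1 + koranyi_norm z.2) `^ p.
  by apply: ge0_ler_powR; rewrite ?nnegrE ?addr_ge0 ?koranyi_ge0 ?koranyi_dist_le ?ltW.
have gE z : g z = 2 `^ (p - 1) * (koranyi_norm z.1 `^ p + koranyi_norm z.2 `^ p) - heis_dist z.1 z.2 `^ p.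
  by rewrite /g SE nd.
have fE z : f z = heis_dist z.1 (heis_opp z.2) `^ p.
  by rewrite /f nd.
pose K := (@unit_box n `*` @unit_box n) `&` [set z | S z = 1].
have cK : compact K.
  apply: compact_closedI; first by apply: compact_setX; exact: compact_unit_box.
  by move/continuous_closedP: cS => /(_ _ (@closed_eq R 1)).
have g0 z : 0 <= g z.
  rewrite gE subr_ge0; apply: le_trans (dle z) _.
  by apply: powR_midpoint_le => //; exact: koranyi_ge0.
have gf z : g z = 0 -> f z = 0.
  rewrite gE fE => /eqP; rewrite subr_eq0 => /eqP gz.
  have ab : koranyi_norm z.1 = koranyi_norm z.2.
    apply/eqP; apply/negPn/negP => ab.
    have := powR_midpoint_lt p1 (koranyi_ge0 z.1) (koranyi_ge0 z.2) ab.
    by rewrite gz ltNge dle.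
  have dab : heis_dist z.1 z.2 = koranyi_norm z.1 + koranyi_norm z.2.
    apply: (powR_injective p0); rewrite ?nnegrE ?addr_ge0 ?koranyi_ge0//.
    apply/eqP; rewrite eq_le dle/= -gz.
    by apply: powR_midpoint_le => //; exact: koranyi_ge0.
  by rewrite antipodal_rigid// powR0// gt_eqF.
have [C C0 CP] := compact_domination cK cf cg eta0 (fun z _ => g0 z) (fun z _ => @gf z).
exists C; [exact: C0|move=> a b].
pose s := koranyi_norm a `^ p + koranyi_norm b `^ p; rewrite -[X in _ <= _ * X]/s.
have s0 : 0 <= s by rewrite addr_ge0 ?powR_ge0.
have [sE|s_neq0] := eqVneq s 0.
  have /andP[/eqP/powR_eq0_eq0 a0 /eqP/powR_eq0_eq0 b0] :
      (koranyi_norm a `^ p == 0) && (koranyi_norm b `^ p == 0).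
    by rewrite -paddr_eq0 ?powR_ge0// -/s sE.
  have d1 : heis_dist a (heis_opp b) = 0.
    by apply/eqP; rewrite eq_le koranyi_ge0 andbT (le_trans (koranyi_dist_le _ _))// koranyi_opp a0 b0 addr0.
  have d2 : heis_dist a b = 0.
    by apply/eqP; rewrite eq_le koranyi_ge0 andbT (le_trans (koranyi_dist_le _ _))// a0 b0 addr0.
  by rewrite d1 d2 sE powR0 ?gt_eqF// !mulr0 addr0.
have s_gt0 : 0 < s by rewrite lt_neqAle eq_sym s_neq0.
pose r := (s^-1) `^ (p^-1).
have r0 : 0 <= r by exact: powR_ge0.
have rp : r `^ p = s^-1.
  by rewrite /r -powRrM mulVf ?gt_eqF// powRr1// invr_ge0.
pose a' : X := heis_dil r a; pose b' : X := heis_dil r b.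
have Sab : S (a', b') = 1.
  rewrite SE /= /a' /b' !koranyi_dil// !powRM ?koranyi_ge0// -mulrDr rp.
  exact: (mulVf s_neq0 : s^-1 * (_ + _) = _).
have k1 : koranyi_norm (a' : heisenberg R n) <= 1 /\ koranyi_norm (b' : heisenberg R n) <= 1.
  move: Sab; rewrite SE /= => Sab.
  have le1 (x : R) : 0 <= x -> x `^ p <= 1 -> x <= 1.
    move=> x0 xp; rewrite leNgt; apply/negP => x1.
    have : 1 `^ p < x `^ p by apply: gt0_ltr_powR => //; rewrite nnegrE.
    by rewrite powR1 ltNge xp.
  split; apply: le1; [exact: koranyi_ge0| |exact: koranyi_ge0|]; rewrite -Sab.
    by rewrite lerDl; exact: powR_ge0.
  by rewrite lerDr; exact: powR_ge0.
have Kab : K (a', b').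
  by split => //; split => /=; apply: koranyi_ball_sub_box; have [] := k1.
have := CP _ Kab; rewrite fE gE /= /a' /b' heis_opp_dil.
rewrite !(heis_dist_dil _ _ r0) !(koranyi_dil _ r0).
rewrite (powRM _ r0 (heis_dist_ge0 a b)).
rewrite (powRM _ r0 (heis_dist_ge0 a (heis_opp b))).
rewrite (powRM _ r0 (koranyi_ge0 a)) (powRM _ r0 (koranyi_ge0 b)).
rewrite rp -mulrDr (mulVf s_neq0 : s^-1 * (_ + _) = _).
move: (heis_dist a (heis_opp b) `^ p) (heis_dist a b `^ p) => d1 d2 h.
have := ler_wpM2l s0 h; rewrite (mulrA s s^-1) mulfV// mul1r.
rewrite (_ : s * (eta + _) =
  eta * s + C * (2 `^ (p - 1) * s - (s * s^-1) * d2)); last by ring.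
rewrite mulfV//; lra.
Qed.

End Stability.

(** * Deviation of a measure from a point *)

Lemma poweR_le (R : realType) (r : R) (x y : \bar R) : 0 <= r -> (0 <= x)%E ->
  (x <= y)%E -> (poweR x r <= poweR y r)%E.
Proof.
move=> r0 x0 xy; have y0 := le_trans x0 xy.
by apply: gt0_ler_poweR; rewrite // in_itv/= ?x0 ?y0 leey.
Qed.

Section LnormNonneg.
Context d (T : measurableType d) (R : realType).
Variables (mu : {measure set T -> \bar R}) (p : R).
Hypothesis p1 : 1 < p.

Lemma Lnorm_nonnegE (f : T -> R) : (forall x, 0 <= f x) ->
  ('N[mu]_p%:E[EFin \o f] = poweR (\int[mu]_x ((f x) `^ p)%:E) p^-1)%E.
Proof.
move=> f0; rewrite unlock /Lnorm; congr (poweR _ _).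
by apply: eq_integral => x _ /=; rewrite ger0_norm.
Qed.

Lemma Lnorm_subadditive (f g h : T -> R) :
  measurable_fun setT f -> measurable_fun setT g -> measurable_fun setT h ->
  (forall x, 0 <= f x) -> (forall x, f x <= g x + h x) ->
  ('N[mu]_p%:E[EFin \o f] <= 'N[mu]_p%:E[EFin \o g] + 'N[mu]_p%:E[EFin \o h])%E.
Proof.
move=> mf mg mh f0 fgh.
apply: le_trans (minkowski_EFin mu mg mh (ltW p1)).
rewrite !Lnorm_nonnegE//; last by move=> x /=; exact: le_trans (fgh x).
have p0 : 0 <= p by exact: le_trans ler01 (ltW p1).
have mp (k : T -> R) : measurable_fun setT k ->
    measurable_fun setT (EFin \o (fun x => k x `^ p)).
  move=> mk; apply/measurable_EFinP.
  by apply: (@measurableT_comp _ _ _ _ _ _ (@powR R ^~ p)) => //; exact: measurable_powR.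
apply: poweR_le; first by rewrite invr_ge0.
  by apply: integral_ge0 => x _; rewrite lee_fin powR_ge0.
apply: ge0_le_integral => //.
- by move=> x _; rewrite lee_fin powR_ge0.
- exact: mp.
- by apply: (mp (g \+ h)); exact: measurable_funD.
- move=> x _; rewrite lee_fin; apply: ge0_ler_powR; rewrite ?nnegrE//.
  exact: le_trans (fgh x).
Qed.

End LnormNonneg.

(** Joint measurability is a genuine condition: [metric_open] generates the
    Borel sets of X, and rho need not be measurable for the product of two
    Borel sigma-algebras when X is not separable. *)
Record measurable_metric {R : realType} {X : pointedType} (rho : X -> X -> R) : Prop := {
  metric_ge0 : forall x y, 0 <= rho x y;
  metric_xx : forall x, rho x x = 0;
  metric_sym : forall x y, rho x y = rho y x;
  metric_triangle : forall x y z, rho x z <= rho x y + rho y z;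
  metric_measurable :
    measurable_fun setT (fun z : (borelType rho * borelType rho)%type => rho z.1 z.2)
}.

Section Deviation.
Context {R : realType} {X : pointedType}.
Variable rho : X -> X -> R.

Local Notation B := (@borelType R X rho).

Definition metric_continuous (f : X -> R) := forall x e, 0 < e ->
  exists2 d, 0 < d & forall y, rho x y < d -> `|f x - f y| < e.

Lemma metric_continuous_measurable (f : X -> R) : metric_continuous f ->
  measurable_fun setT (f : B -> R).
Proof.
move=> cf; apply: (measurability _ (@RGenOpens.measurableE R)).
move=> _ [_ [a [b ->] <-]]; rewrite setTI.
apply: sub_sigma_algebra => x /=.
rewrite in_itv/= => /andP[ax xb].
have [|d d0 dP] := cf x (Num.min (f x - a) (b - f x)).
  by rewrite lt_min !subr_gt0 ax xb.
exists d => // y /dP; rewrite lt_min => /andP[h1 h2]; rewrite in_itv/=.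
move: h1 h2; rewrite !ltr_norml => /andP[? ?] /andP[? ?].
by apply/andP; split; lra.
Qed.

Hypothesis rho_metric : measurable_metric rho.

Let rho_ge0 := metric_ge0 rho_metric.
Let rho_xx := metric_xx rho_metric.
Let rhoC := metric_sym rho_metric.
Let rho_triangle := metric_triangle rho_metric.
Let rho_measurable := metric_measurable rho_metric.

Lemma rho_measurablel (a : X) : measurable_fun setT (fun x : B => rho x a).
Proof.
have mp : measurable_fun setT (fun x : B => (x, a : B)).
  exact: measurable_fun_pair.
exact: (measurableT_comp rho_measurable mp).
Qed.

Variable p : R.
Hypothesis p1 : 1 < p.

Let p0 : 0 < p. Proof. exact: lt_trans ltr01 p1. Qed.

Local Notation W := (@wass_dist R X rho p).
Local Notation PB := (probability B R).

Local Open Scope ereal_scope.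

(** [dev mu a] is the p-Wasserstein distance from mu to the Dirac mass at a,
    for which there is only one coupling. *)
Definition dev (mu : PB) (a : X) : \bar R := 'N[mu]_p%:E[EFin \o (fun x : B => rho x a)].

Lemma dev_ge0 mu a : 0 <= dev mu a.
Proof. exact: Lnorm_ge0. Qed.

Lemma Lnorm_cst_prob d (T : measurableType d) (P : probability T R) (r : R) : (0 <= r)%R ->
  'N[P]_p%:E[EFin \o (fun=> r)] = r%:E.
Proof.
move=> r0; rewrite Lnorm_nonnegE//.
have -> : \int[P]_x (r `^ p)%:E = (r `^ p)%:E.
  rewrite (integral_cst P measurableT) -[RHS]mule1; congr (_ * _).
  exact: probability_setT.
rewrite -poweR_EFin.
by rewrite -poweRrM mulfV ?gt_eqF ?p0// poweRe1.
Qed.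

Lemma dev_triangle (mu : PB) a b : dev mu b <= dev mu a + (rho a b)%:E.
Proof.
rewrite -(Lnorm_cst_prob mu (rho_ge0 a b)).
apply: Lnorm_subadditive => //; by [exact: rho_measurablel|move=> x; exact: rho_ge0].
Qed.

Lemma rho_le_dev (mu : PB) a b : (rho a b)%:E <= dev mu a + dev mu b.
Proof.
rewrite -(Lnorm_cst_prob mu (rho_ge0 a b)).
apply: Lnorm_subadditive => //; try exact: rho_measurablel.
by move=> x; rewrite (rhoC x a).
Qed.

Lemma integral_marginal (Pi : probability (B * B)%type R) (mu : PB)
    (phi : (B * B)%type -> B) (f : B -> R) :
  measurable_fun setT phi -> measurable_fun setT f ->
  (forall A : set B, measurable A -> Pi (phi @^-1` A) = mu A) ->
  \int[Pi]_z (f (phi z) `^ p)%:E = \int[mu]_x (f x `^ p)%:E.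
Proof.
move=> mphi mf h.
transitivity (\int[pushforward Pi phi]_x (f x `^ p)%:E).
  rewrite ge0_integral_pushforward//.
  - apply/measurable_EFinP.
    by apply: (@measurableT_comp _ _ _ _ _ _ (@powR R ^~ p)) => //; exact: measurable_powR.
  - by move=> y _; rewrite lee_fin powR_ge0.
apply: eq_measure_integral => A mA _; exact: h.
Qed.

Lemma dev_marginal (Pi : probability (B * B)%type R) (mu : PB)
    (phi : (B * B)%type -> B) a :
  measurable_fun setT phi ->
  (forall A : set B, measurable A -> Pi (phi @^-1` A) = mu A) ->
  dev mu a = 'N[Pi]_p%:E[EFin \o (fun z => rho (phi z) a)].
Proof.
move=> mphi h; rewrite /dev !Lnorm_nonnegE//; congr (poweR _ _).
by rewrite -(integral_marginal mphi (rho_measurablel a) h).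
Qed.

Definition plan_norm (Pi : probability (B * B)%type R) : \bar R :=
  poweR (transport_cost p Pi) p^-1.

Lemma plan_normE Pi : plan_norm Pi = 'N[Pi]_p%:E[EFin \o (fun z => rho z.1 z.2)].
Proof. by rewrite Lnorm_nonnegE. Qed.

(** The triangle inequality of the Wasserstein distance through a Dirac mass:
    Minkowski's inequality on the given plan suffices, since a plan between a
    measure and a Dirac mass is determined by the measure. *)
Lemma dev_le_plan mu nu Pi a : coupling mu nu Pi ->
  dev mu a <= plan_norm Pi + dev nu a.
Proof.
move=> [h1 h2].
rewrite (dev_marginal a measurable_fst h1) (dev_marginal a measurable_snd h2).
rewrite plan_normE; apply: Lnorm_subadditive => //.
- exact: (measurableT_comp (rho_measurablel a)).
- exact: (measurableT_comp (rho_measurablel a)).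
Qed.

Lemma plan_le_dev mu nu Pi a : coupling mu nu Pi ->
  plan_norm Pi <= dev mu a + dev nu a.
Proof.
move=> [h1 h2].
rewrite (dev_marginal a measurable_fst h1) (dev_marginal a measurable_snd h2).
rewrite plan_normE; apply: Lnorm_subadditive => //.
- exact: (measurableT_comp (rho_measurablel a)).
- exact: (measurableT_comp (rho_measurablel a)).
- by move=> z; rewrite (rhoC z.2 a).
Qed.

Definition indep_coupling (mu nu : PB) : probability (B * B)%type R :=
  (mu \x nu)%E.

Lemma indep_couplingP mu nu : coupling mu nu (indep_coupling mu nu).
Proof.
split => A mA; rewrite /indep_coupling.
  have -> : fst @^-1` A = A `*` [set: B] :> set (B * B) by apply/seteqP; split => z //= [].
  by rewrite /= product_measure1E// [X in _ * X](probability_setT nu) mule1.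
have -> : snd @^-1` A = [set: B] `*` A :> set (B * B) by apply/seteqP; split => z //= [].
by rewrite /= product_measure1E// [X in X * _](probability_setT mu) mul1e.
Qed.

Lemma transport_cost_ge0 Pi : 0 <= transport_cost (rho := rho) p Pi.
Proof. by apply: integral_ge0 => z _; rewrite lee_fin powR_ge0. Qed.

Lemma inf_cost_ge0 mu nu :
  0 <= ereal_inf [set transport_cost (rho := rho) p Pi | Pi in coupling mu nu].
Proof. by apply: le_ereal_inf_tmp => _ [Pi _ <-]; exact: transport_cost_ge0. Qed.

Lemma wass_le_plan (w1 w2 : wasserstein rho p) Pi : coupling w1 w2 Pi ->
  W w1 w2 <= plan_norm Pi.
Proof.
move=> h; apply: poweR_le; first by rewrite invr_ge0 ltW ?p0.
  exact: inf_cost_ge0.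
by apply: ereal_inf_lbound; exists Pi.
Qed.

Lemma wass_plan_exists (w1 w2 : wasserstein rho p) (r e : R) : (0 < e)%R ->
  W w1 w2 = r%:E ->
  exists2 Pi, coupling w1 w2 Pi & plan_norm Pi <= (r + e)%:E.
Proof.
move=> e0 Wr.
have r0 : (0 <= r)%R by rewrite -lee_fin -Wr poweR_ge0.
set I := ereal_inf [set transport_cost (rho := rho) p Pi | Pi in coupling w1 w2].
have IE : I = (r `^ p)%:E.
  rewrite -poweR_EFin -Wr -poweRrM mulVf ?gt_eqF ?p0// poweRe1//.
  exact: inf_cost_ge0.
have : I < ((r + e) `^ p)%:E.
  rewrite IE lte_fin; apply: gt0_ltr_powR; rewrite ?nnegrE ?p0//; lra.
move=> /ereal_inf_lt [_ [Pi cPi <-] h]; exists Pi => //.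
have -> : (r + e)%:E = poweR ((r + e) `^ p)%:E p^-1.
  by rewrite poweR_EFin -powRrM mulfV ?gt_eqF ?p0// powRr1//; lra.
apply: poweR_le; first by rewrite invr_ge0 ltW ?p0.
  exact: transport_cost_ge0.
exact: ltW.
Qed.

Lemma dev_fin (w : wasserstein rho p) a : dev w a \is a fin_num.
Proof.
have [x0 hx0] := wass_moment w.
rewrite ge0_fin_numE ?dev_ge0//.
apply: le_lt_trans (dev_triangle w x0 a) _.
by rewrite lte_add_pinfty ?ltry// /dev Lnorm_nonnegE// poweR_lty.
Qed.

Definition rdev (w : wasserstein rho p) a : R := fine (dev w a).

Lemma rdevE w a : (rdev w a)%:E = dev w a.
Proof. by rewrite fineK// dev_fin. Qed.

Local Close Scope ereal_scope.

Lemma rdev_ge0 w a : 0 <= rdev w a.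
Proof. by rewrite -lee_fin rdevE dev_ge0. Qed.

Lemma rdev_triangle w a b : rdev w b <= rdev w a + rho a b.
Proof. by rewrite -lee_fin EFinD !rdevE dev_triangle. Qed.

Lemma rho_le_rdev w a b : rho a b <= rdev w a + rdev w b.
Proof. by rewrite -lee_fin EFinD !rdevE rho_le_dev. Qed.

Lemma rdev_le_wass w1 w2 a r : W w1 w2 = r%:E -> rdev w1 a <= r + rdev w2 a.
Proof.
move=> Wr; apply/ler_addgt0Pr => e e0.
have [Pi cPi hPi] := wass_plan_exists e0 Wr.
rewrite -lee_fin addrAC EFinD !rdevE; apply: le_trans (dev_le_plan a cPi) _.
exact: leeD.
Qed.

Lemma wass_le_rdev w1 w2 a : (W w1 w2 <= (rdev w1 a + rdev w2 a)%:E)%E.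
Proof.
rewrite EFinD !rdevE; have h := indep_couplingP w1 w2.
by apply: le_trans (wass_le_plan h) _; exact: plan_le_dev.
Qed.

Lemma moment_rdev (w : wasserstein rho p) a : (\int[w]_x (rho x a `^ p)%:E)%E = (rdev w a `^ p)%:E.
Proof.
rewrite -poweR_EFin rdevE /dev Lnorm_nonnegE//.
rewrite -poweRrM mulVf ?gt_eqF ?p0// poweRe1//.
by apply: integral_ge0 => x _; rewrite lee_fin powR_ge0.
Qed.

Lemma dirac_moment (a : X) : finite_moment p (\d_(a : B) : PB).
Proof.
exists a; rewrite integral_dirac//.
  by rewrite rho_xx powR0 ?gt_eqF ?p0// mule0.
apply/measurable_EFinP.
apply: (@measurableT_comp _ _ _ _ _ _ (@powR R ^~ p)) => //.
exact: rho_measurablel.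
Qed.

Definition wdirac (a : X) : wasserstein rho p := Wasserstein (dirac_moment a).

Lemma rdev_dirac a b : rdev (wdirac a) b = rho a b.
Proof.
apply: (powR_injective p0); rewrite ?nnegrE ?rdev_ge0//.
apply/EFin_inj; rewrite -moment_rdev integral_dirac//.
  by rewrite diracT mul1e.
apply/measurable_EFinP.
apply: (@measurableT_comp _ _ _ _ _ _ (@powR R ^~ p)) => //.
exact: rho_measurablel.
Qed.

Lemma wass_dirac a b : W (wdirac a) (wdirac b) = (rho a b)%:E.
Proof.
have Wle := wass_le_rdev (wdirac a) (wdirac b) b.
rewrite !rdev_dirac rho_xx addr0 in Wle.
have W0 : (0 <= W (wdirac a) (wdirac b))%E by exact: poweR_ge0.
have Wfin : W (wdirac a) (wdirac b) \is a fin_num.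
  by rewrite ge0_fin_numE// (le_lt_trans Wle)// ltry.
apply/eqP; rewrite eq_le Wle/=.
have := rdev_le_wass b (esym (fineK Wfin)).
by rewrite !rdev_dirac rho_xx addr0 -lee_fin fineK.
Qed.

End Deviation.

(** * The Koranyi metric is Borel *)

Section HeisMeasurable.
Context {R : realType} {n : nat}.
Local Notation H := (heisenberg R n).
Local Notation B := (@borelType R H (@heis_dist R n)).

(** Measurability of the coordinates rather than for the Borel sets of the
    metric: the distance is an explicit function of the coordinates, and group
    inversion acts on them by signs. *)
Definition coord_measurable d (T : measurableType d) (f : T -> H) :=
  [/\ forall i, measurable_fun setT (fun t => (f t).1.1 ord0 i),
      forall i, measurable_fun setT (fun t => (f t).1.2 ord0 i) &
      measurable_fun setT (fun t => (f t).2)].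

Lemma coord_measurable_id : @coord_measurable _ B id.
Proof.
split=> [i|i|]; apply: metric_continuous_measurable => a e e0.
- by exists e => // b; apply: le_lt_trans; have [] := coord_dist_le a b i.
- by exists e => // b; apply: le_lt_trans; have [] := coord_dist_le a b i.
have k0 := koranyi_ge0 a.
have N0 : 0 < 1 + 2 * koranyi_norm a by lra.
exists (Num.min 1 (e / (1 + 2 * koranyi_norm a))).
  by rewrite lt_min ltr01 divr_gt0.
move=> b; rewrite lt_min => /andP[d1 d2]; apply: le_lt_trans (vert_dist_le a b) _.
rewrite ltr_pdivlMr// in d2; apply: le_lt_trans d2.
have := heis_dist_ge0 a b; nra.
Qed.

Lemma coord_measurable_comp d d' (T : measurableType d) (U : measurableType d')
  (g : T -> U) (f : U -> H) : measurable_fun setT g -> coord_measurable f ->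
  coord_measurable (f \o g).
Proof.
move=> mg [m1 m2 m3]; split=> [i|i|].
- exact: (measurableT_comp (m1 i) mg).
- exact: (measurableT_comp (m2 i) mg).
- exact: (measurableT_comp m3 mg).
Qed.

Lemma coord_measurable_opp d (T : measurableType d) (f : T -> H) :
  coord_measurable f -> coord_measurable (fun t => heis_opp (f t)).
Proof.
move=> [m1 m2 m3]; split=> [i|i|].
- by under eq_fun do rewrite /= mxE; exact: measurableT_comp.
- by under eq_fun do rewrite /= mxE; exact: measurableT_comp.
- exact: measurableT_comp.
Qed.

Lemma heis_dist_measurable d (T : measurableType d) (f g : T -> H) :
  coord_measurable f -> coord_measurable g ->
  measurable_fun setT (fun t => heis_dist (f t) (g t)).
Proof.
have mdot (h k : T -> H) : coord_measurable h -> coord_measurable k ->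
    measurable_fun setT (fun t => hdot (h t) (k t)).
  move=> [h1 h2 _] [k1 k2 _]; apply: measurable_sum => i.
  by apply: measurable_funD; apply: measurable_funM.
move=> mf mg.
have msym : measurable_fun setT (fun t => hsym (f t) (g t)).
  move: mf mg => [h1 h2 _] [k1 k2 _]; apply: measurable_sum => i.
  by apply: measurable_funB; apply: measurable_funM.
have -> : (fun t => heis_dist (f t) (g t)) = (fun t =>
   ((hdot (f t) (f t) + hdot (g t) (g t) - 2 * hdot (f t) (g t)) ^+ 2
   + ((g t).2 - (f t).2 - 2 * hsym (f t) (g t)) ^+ 2) `^ 4^-1).
  apply/funext => t; rewrite -heis_dist_exp4 -powR_mulrn ?heis_dist_ge0//.
  by rewrite -powRrM mulfV ?pnatr_eq0// powRr1// heis_dist_ge0.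
apply: (measurableT_comp (measurable_powR _)).
apply: measurable_funD; apply: measurable_funX; apply: measurable_funB.
- by apply: measurable_funD; exact: mdot.
- by apply: measurable_funM => //; exact: mdot.
- by apply: measurable_funB; [case: mg|case: mf].
- exact: measurable_funM.
Qed.

Lemma coord_measurable_fst : @coord_measurable _ (B * B)%type fst.
Proof. exact: (coord_measurable_comp (measurable_fst) coord_measurable_id). Qed.

Lemma coord_measurable_snd : @coord_measurable _ (B * B)%type snd.
Proof. exact: (coord_measurable_comp (measurable_snd) coord_measurable_id). Qed.

Lemma heis_metric : measurable_metric (@heis_dist R n).
Proof.
split; [exact: heis_dist_ge0|exact: heis_distxx|exact: heis_distC
  |exact: heis_dist_triangle|].
by apply: heis_dist_measurable; [exact: coord_measurable_fst|exact: coord_measurable_snd].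
Qed.

End HeisMeasurable.

(** * Opposite measures far from the origin are almost Dirac masses *)

Section AlmostDirac.
Context {R : realType} {n : nat}.
Local Notation H := (heisenberg R n).
Local Notation hd := (@heis_dist R n).
Local Notation B := (@borelType R H hd).
Variable p : R.
Hypothesis p1 : 1 < p.

Let hm := @heis_metric R n.
Let p_gt0 : 0 < p. Proof. exact: lt_trans ltr01 p1. Qed.

Lemma powR_measurable d (T : measurableType d) (f : T -> R) :
  measurable_fun setT f -> measurable_fun setT (fun t => (f t `^ p)%:E).
Proof.
by move=> mf; apply/measurable_EFinP; exact: (measurableT_comp (measurable_powR _)).
Qed.

Let m_anti : measurable_fun setT (fun z : (B * B)%type => (heis_dist z.2 (heis_opp z.1) `^ p)%:E).
Proof.
apply: powR_measurable; apply: heis_dist_measurable; first exact: coord_measurable_snd.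
by apply: coord_measurable_opp; exact: coord_measurable_fst.
Qed.

(** By Tonelli the integral is the average, over y distributed as w1, of the
    p-th power of the deviation of w2 from the inverse of y. *)
Lemma antipodal_cost_ge (w1 w2 : wasserstein hd p) (r : R) : 0 <= r ->
  (forall a, r <= rdev w2 a) ->
  ((r `^ p)%:E <= \int[indep_coupling w1 w2]_z (heis_dist z.2 (heis_opp z.1) `^ p)%:E)%E.
Proof.
move=> r0 rw.
rewrite /indep_coupling/= fubini_tonelli1//; last first.
  by move=> z; rewrite lee_fin powR_ge0.
have -> : ((r `^ p)%:E = \int[w1]_x (r `^ p)%:E)%E.
  rewrite (integral_cst w1 measurableT) -[LHS]mule1; congr (_ * _)%E.
  by symmetry; exact: probability_setT.
apply: ge0_le_integral => //.
- by move=> x _; rewrite lee_fin powR_ge0.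
- by apply: measurable_fun_fubini_tonelli_F => // z; rewrite lee_fin powR_ge0.
- move=> y _; rewrite /fubini_F /=.
  rewrite (moment_rdev hm p1 w2 (heis_opp y)).
  by rewrite lee_fin ge0_ler_powR// ?nnegrE// ?(ltW p_gt0)// (le_trans r0).
Qed.

Lemma plan_cost_ge (w1 w2 : wasserstein hd p) (r : R) : 0 <= r ->
  wass_dist w1 w2 = r%:E ->
  ((r `^ p)%:E <= \int[indep_coupling w1 w2]_z (heis_dist z.1 z.2 `^ p)%:E)%E.
Proof.
move=> r0 Wr; have := wass_le_plan p1 (indep_couplingP w1 w2); rewrite Wr /plan_norm => h.
have c0 := transport_cost_ge0 p (indep_coupling w1 w2).
rewrite -poweR_EFin -[X in (_ <= X)%E]poweRe1//.
rewrite -[in X in (_ <= X)%E](mulVf (lt0r_neq0 p_gt0)) poweRrM.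
by apply: poweR_le => //; exact: ltW.
Qed.

Lemma integral_defect_le d (T : measurableType d) (mu : {measure set T -> \bar R})
    (f1 f2 g1 g2 : T -> R) (C K : R) :
  0 <= C -> 0 <= K ->
  (forall z, 0 <= f1 z) -> measurable_fun setT (fun z => (f1 z)%:E) ->
  (forall z, 0 <= f2 z) -> measurable_fun setT (fun z => (f2 z)%:E) ->
  (forall z, 0 <= g1 z) -> measurable_fun setT (fun z => (g1 z)%:E) ->
  (forall z, 0 <= g2 z) -> measurable_fun setT (fun z => (g2 z)%:E) ->
  (forall z, f1 z + C * f2 z <= K * (g1 z + g2 z)) ->
  (\int[mu]_z (f1 z)%:E + C%:E * \int[mu]_z (f2 z)%:E
    <= K%:E * (\int[mu]_z (g1 z)%:E + \int[mu]_z (g2 z)%:E))%E.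
Proof.
move=> C0 K0 f10 mf1 f20 mf2 g10 mg1 g20 mg2 h.
rewrite -ge0_integralZl//; last by move=> z _; rewrite lee_fin.
rewrite -!ge0_integralD//; try by move=> z _; rewrite lee_fin ?mulr_ge0.
- rewrite -ge0_integralZl//; last 2 first.
  + exact: emeasurable_funD.
  + by move=> z _; rewrite lee_fin addr_ge0.
  apply: ge0_le_integral => //.
  + by move=> z _; rewrite lee_fin addr_ge0// mulr_ge0.
  + by apply: emeasurable_funD => //; exact: measurable_funeM.
  + by apply: measurable_funeM; exact: emeasurable_funD.
  + by move=> z _; rewrite lee_fin; exact: h.
- exact: measurable_funeM.
Qed.

(** [antipodal_defect] integrated against the product of w1 and w2, with a
    distributed as w2 and b as w1. *)
Lemma antipodal_integral (eta C : R) (w1 w2 : wasserstein hd p) (t s : R) :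
  0 <= C -> 0 <= eta -> 0 <= t -> 
  (forall a b : H, heis_dist a (heis_opp b) `^ p + C * heis_dist a b `^ p <=
    (eta + C * 2 `^ (p - 1)) * (koranyi_norm a `^ p + koranyi_norm b `^ p)) ->
  rdev w1 heis0 <= s -> rdev w2 heis0 <= s ->
  wass_dist w1 w2 = (2 * t)%:E ->
  forall r, 0 <= r -> (forall a, r <= rdev w2 a) ->
  r `^ p + C * (2 * t) `^ p <= (eta + C * 2 `^ (p - 1)) * (s `^ p + s `^ p).
Proof.
move=> C0 eta0 t0 defect ws1 ws2 Wt r r0 hr.
set K := eta + _.
have K0 : 0 <= K by rewrite addr_ge0// mulr_ge0// powR_ge0.
have h1 := antipodal_cost_ge w1 r0 hr.
have h2 := plan_cost_ge (mulr_ge0 (ler0n _ 2) t0) Wt.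
set Pi := indep_coupling w1 w2 in h1 h2.
have [c1 c2] : coupling w1 w2 Pi := indep_couplingP w1 w2.
have mrho0 := rho_measurablel hm (heis0 : H).
have e1 := integral_marginal p measurable_fst mrho0 c1.
have e2 := integral_marginal p measurable_snd mrho0 c2.
rewrite (moment_rdev hm p1 w1 heis0) in e1.
rewrite (moment_rdev hm p1 w2 heis0) in e2.
have md : measurable_fun setT (fun z : (B * B)%type => (heis_dist (z.1 : H) z.2 `^ p)%:E).
  by apply: powR_measurable; exact: metric_measurable.
have m1 : measurable_fun setT (fun z : (B * B)%type => (heis_dist (z.1 : H) heis0 `^ p)%:E).
  by apply: powR_measurable; exact: (measurableT_comp mrho0 measurable_fst).
have m2 : measurable_fun setT (fun z : (B * B)%type => (heis_dist (z.2 : H) heis0 `^ p)%:E).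
  by apply: powR_measurable; exact: (measurableT_comp mrho0 measurable_snd).
have pw (x : R) : (0 <= (x `^ p)%:E)%E by rewrite lee_fin powR_ge0.
have C0' : (0 <= C%:E)%E by [].
have K0' : (0 <= K%:E)%E by [].
pose f1 (z : (B * B)%type) := heis_dist z.2 (heis_opp z.1) `^ p.
pose f2 (z : (B * B)%type) := heis_dist (z.1 : H) z.2 `^ p.
pose g1 (z : (B * B)%type) := heis_dist (z.1 : H) heis0 `^ p.
pose g2 (z : (B * B)%type) := heis_dist (z.2 : H) heis0 `^ p.
have pointwise z : f1 z + C * f2 z <= K * (g1 z + g2 z).
  rewrite /f1 /f2 /g1 /g2 (heis_distC z.1 z.2) (heis_distC z.1 heis0).
  rewrite (heis_distC z.2 heis0) (heis_dist0 z.1) (heis_dist0 z.2).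
  rewrite [X in _ <= K * X]addrC; exact: (defect z.2 z.1).
have h3 : (_ <= _)%E := integral_defect_le Pi C0 K0 (fun z => powR_ge0 _ _ : 0 <= f1 z) m_anti
  (fun z => powR_ge0 _ _ : 0 <= f2 z) md (fun z => powR_ge0 _ _ : 0 <= g1 z) m1
  (fun z => powR_ge0 _ _ : 0 <= g2 z) m2 pointwise.
have e1' : (\int[Pi]_z (g1 z)%:E)%E = (rdev w1 heis0 `^ p)%:E by exact: e1.
have e2' : (\int[Pi]_z (g2 z)%:E)%E = (rdev w2 heis0 `^ p)%:E by exact: e2.
have h1' : ((r `^ p)%:E <= \int[Pi]_z (f1 z)%:E)%E by exact: h1.
have h2' : (((2 * t) `^ p)%:E <= \int[Pi]_z (f2 z)%:E)%E by exact: h2.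
clearbody f1 f2 g1 g2; move: h3; rewrite e1' e2'; move: h1' h2'.
move: (\int[Pi]_z (f1 z)%:E)%E (\int[Pi]_z (f2 z)%:E)%E => I1 I2 {}h1 {}h2 h3.
rewrite -lee_fin EFinD (EFinM C) (EFinM K) EFinD.
apply: (@le_trans _ _ (I1 + C%:E * I2)%E).
  by apply: leeD; [exact: h1|apply: lee_wpmul2l; [exact: C0'|exact: h2]].
apply: le_trans h3 _.
have p0' : 0 <= p by exact: ltW.
have n1 := rdev_ge0 hm p1 w1 heis0; have n2 := rdev_ge0 hm p1 w2 heis0.
apply: lee_wpmul2l; first exact: K0'.
rewrite -EFinD lee_fin; apply: lerD; apply: ge0_ler_powR => //.
- exact: le_trans n1 ws1.
- exact: le_trans n2 ws2.
Qed.

(** If all deviations of w2 exceeded e t, then [antipodal_integral] with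
    s = t + c would give, after division by t^p and letting t grow,
    e^p + C 2^p <= 2 eta + C 2^p, which fails once eta is small against e^p. *)
Lemma almost_dirac (c e : R) : 0 <= c -> 0 < e ->
  exists2 T, 0 < T & forall t, T <= t -> forall w1 w2 : wasserstein hd p,
    rdev w1 heis0 <= t + c -> rdev w2 heis0 <= t + c ->
    wass_dist w1 w2 = (2 * t)%:E -> exists a, rdev w2 a <= e * t.
Proof.
move=> c0 e0.
pose E := e `^ p; have E0 : 0 < E by exact: powR_gt0.
have eta0 : 0 < E / 8 by lra.
have [C C0 defect] := @antipodal_defect R n p (E / 8) p1 eta0.
pose K := C * 2 `^ p; have K0 : 0 <= K by rewrite mulr_ge0// powR_ge0.
(* q > 1 is the room left for ((t + c) / t)^p once eta = E / 8. *)
pose q := (E + K) / (E / 2 + K).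
have D0 : 0 < E / 2 + K by lra.
have q1 : 1 < q by rewrite /q ltr_pdivlMr//; lra.
pose s := q `^ p^-1.
have s1 : 1 < s.
  rewrite -[X in X < _](_ : 1 `^ p^-1 = 1); last by rewrite powR1.
  apply: gt0_ltr_powR; rewrite ?invr_gt0 ?nnegrE//.
  exact: le_trans ler01 (ltW q1).
have sp : s `^ p = q.
  by rewrite /s -powRrM mulVf ?gt_eqF ?p_gt0// powRr1// (le_trans ler01 (ltW q1)).
have s10 : 0 < s - 1 by rewrite subr_gt0.
(* From this radius on, t + c <= s t. *)
exists (c / (s - 1) + 1); first by rewrite ltr_wpDl ?divr_ge0// ltW.
move=> t tT w1 w2 h1 h2 Wt; apply: contrapT => nex.
have t0 : 0 < t.
  by apply: lt_le_trans tT; rewrite ltr_wpDl ?divr_ge0// ltW.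
have tc : t + c <= s * t.
  have : c / (s - 1) <= t by lra.
  by rewrite ler_pdivrMr//; lra.
have far a : e * t <= rdev w2 a.
  by rewrite leNgt; apply/negP => /ltW h; apply: nex; exists a.
have := antipodal_integral C0 (ltW eta0) (ltW t0) defect (le_trans h1 tc)
  (le_trans h2 tc) Wt (ltW (mulr_gt0 e0 t0)) far.
have s0 : 0 <= s by lra.
have tp : 0 < t `^ p by exact: powR_gt0.
rewrite (powRM _ (ltW e0) (ltW t0)) (powRM _ (ler0n _ 2) (ltW t0)) (powRM _ s0 (ltW t0)) sp.
rewrite -/E.
have -> : C * (2 `^ p * t `^ p) = K * t `^ p by rewrite mulrA.
have -> : (E / 8 + C * 2 `^ (p - 1)) * (q * t `^ p + q * t `^ p)
  = (E / 4 + K) * q * t `^ p.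
  by rewrite /K (powR_predE p1 (ler0n _ 2)); lra.
rewrite -mulrDl ler_pM2r// => bad.
have qE : q * (E / 2 + K) = E + K by rewrite /q divfK// gt_eqF.
have : 0 < q * (E / 4) by rewrite mulr_gt0 ?divr_gt0//; lra.
by move: bad qE; lra.
Qed.

End AlmostDirac.

(** * From an embedding to almost isometric frames *)

Section Euclid.
Context {R : realType} {k : nat}.
Implicit Types u v w : 'rV[R]_k.

Lemma euclidean_distZ (t : R) u v : 0 <= t ->
  euclidean_dist (t *: u) (t *: v) = t * euclidean_dist u v.
Proof.
move=> t0; have tE : t = Num.sqrt (t ^+ 2) by rewrite sqrtr_sqr ger0_norm.
rewrite [X in _ = X * _]tE /euclidean_dist -sqrtrM ?sqr_ge0//.
by congr Num.sqrt; rewrite mulr_sumr; apply: eq_bigr => i _; rewrite !mxE; ring.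
Qed.

Lemma euclidean_distN u : euclidean_dist (- u) u = 2 * euclidean_dist u 0.
Proof.
have tE : 2 = Num.sqrt (2 ^+ 2) :> R by rewrite sqrtr_sqr ger0_norm.
rewrite [X in _ = X * _]tE /euclidean_dist -sqrtrM ?sqr_ge0//.
by congr Num.sqrt; rewrite mulr_sumr; apply: eq_bigr => i _; rewrite !mxE; ring.
Qed.

Lemma euclidean_dist_opp0 u : euclidean_dist (- u) 0 = euclidean_dist u 0.
Proof. by congr Num.sqrt; apply: eq_bigr => i _; rewrite !mxE; ring. Qed.

Lemma euclidean_dist_delta (i j : 'I_k) (s r : R) : i != j ->
  euclidean_dist (s *: delta_mx ord0 i) (r *: delta_mx ord0 j)
  = Num.sqrt (s ^+ 2 + r ^+ 2).
Proof.
move=> ij; congr Num.sqrt.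
rewrite (bigD1 i)//= (bigD1 j) 1?eq_sym//= big1 => [|l /andP[li lj]].
  rewrite !mxE !eqxx (negbTE ij) [j == i]eq_sym (negbTE ij)/=; ring.
by rewrite !mxE (negbTE li) (negbTE lj)/= ?andbF; ring.
Qed.

Lemma euclidean_dist_delta0 (i : 'I_k) : euclidean_dist (delta_mx ord0 i : 'rV[R]_k) 0 = 1.
Proof.
rewrite /euclidean_dist (bigD1 i)//= big1 => [|l li].
  by rewrite !mxE !eqxx /= subr0 addr0 expr1n sqrtr1.
by rewrite !mxE (negbTE li) ?andbF subr0 expr0n.
Qed.

End Euclid.

Section Config.
Context {R : realType} {n : nat}.
Local Notation H := (heisenberg R n).
Local Notation hd := (@heis_dist R n).

(** [antipodal_defect] again, with exponent 2 and for points instead of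
    measures. *)
Lemma antipode_near (delta : R) : 0 < delta -> exists2 e, 0 < e &
  forall a b : H, koranyi_norm a <= 1 + e -> koranyi_norm b <= 1 + e ->
    2 - e <= heis_dist a b -> heis_dist a (heis_opp b) <= delta.
Proof.
move=> d0.
have eta0 : 0 < delta ^+ 2 / 16 by rewrite divr_gt0// exprn_gt0.
have [C C0 defect] := @antipodal_defect R n 2 _ (ltr1n R 2) eta0.
(* As (1 + e)^2 <= 1 + 3 e and (2 - e)^2 >= 4 - 4 e, the defect inequality with
   eta = delta^2 / 16 bounds the square by 2 eta + 6 eta e + 16 C e. *)
have D0 : 0 < delta ^+ 2 / (32 * (C + 1)).
  by rewrite divr_gt0 ?exprn_gt0// mulr_gt0//; lra.
exists (Num.min 1 (delta ^+ 2 / (32 * (C + 1)))); first by rewrite lt_min ltr01.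
set e := Num.min _ _ => a b na nb dab.
have e0 : 0 < e by rewrite lt_min ltr01.
have e1 : e <= 1 by rewrite ge_min lexx.
have e2 : 32 * (C + 1) * e <= delta ^+ 2.
  rewrite mulrC -ler_pdivlMr; first by rewrite ge_min lexx orbT.
  by rewrite mulr_gt0//; lra.
rewrite -ler_sqr ?nnegrE ?heis_dist_ge0 ?(ltW d0)//.
have := defect a b.
have p2 (x : R) : 0 <= x -> x `^ 2 = x ^+ 2 by move=> x0; rewrite -powR_mulrn.
rewrite (p2 _ (heis_dist_ge0 _ _)) (p2 _ (heis_dist_ge0 _ _)).
rewrite (p2 _ (koranyi_ge0 _)) (p2 _ (koranyi_ge0 _)).
rewrite (_ : 2 - 1 = 1); last by ring.
rewrite powRr1//.
have na0 := koranyi_ge0 a; have nb0 := koranyi_ge0 b.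
have sq (x : R) : 0 <= x -> x <= 1 + e -> x ^+ 2 <= 1 + 3 * e.
  move=> x0 xe; apply: (@le_trans _ _ ((1 + e) ^+ 2)); last by nra.
  by rewrite ler_sqr ?nnegrE//; lra.
have sa := sq _ na0 na; have sb := sq _ nb0 nb.
have sd : 4 - 4 * e <= heis_dist a b ^+ 2.
  apply: (@le_trans _ _ ((2 - e) ^+ 2)); first by have := sqr_ge0 e; lra.
  by rewrite ler_sqr ?nnegrE ?heis_dist_ge0//; lra.
move: (heis_dist a b ^+ 2) sd (heis_dist a (heis_opp b) ^+ 2) => D sd D'.
move: (koranyi_norm a ^+ 2) (koranyi_norm b ^+ 2) sa sb => x y sa sb.
set E := delta ^+ 2 / 16 => h.
have dE : delta ^+ 2 = 16 * E by rewrite /E; lra.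
have k1 : C * (4 - 4 * e) <= C * D by rewrite ler_wpM2l.
have k2 : (E + C * 2) * (x + y) <= (E + C * 2) * (2 + 6 * e).
  by rewrite ler_wpM2l ?addr_ge0 ?mulr_ge0// ?(ltW eta0)//; lra.
have k3 : E * e <= E by rewrite ler_piMr// ltW.
have : 0 <= C * e by rewrite mulr_ge0// ltW.
rewrite dE in e2 *; lra.
Qed.

Variable p : R.
Hypothesis p1 : 1 < p.
Let hm := @heis_metric R n.

(** At a large radius t the measures f (t v), |v| = 1, are all within o(t) of
    Dirac masses, so the distances between these Dirac masses are t |v - w|
    up to o(t); the dilation of factor 1 / t brings them back to scale 1. *)
Lemma embedding_unit_sphere (k : nat) (f : 'rV[R]_k -> wasserstein hd p) (e : R) :
  0 < e -> isometric_embedding euclidean_dist (wass_dist (rho := hd) (p := p)) f ->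
  exists x : 'rV[R]_k -> H, forall v, euclidean_dist v 0 = 1 ->
    `|koranyi_norm (x v) - 1| <= e /\
    forall w, euclidean_dist w 0 = 1 ->
      `|heis_dist (x v) (x w) - euclidean_dist v w| <= e.
Proof.
move=> e0 iso.
pose c := rdev (f 0) heis0.
have c0 : 0 <= c := rdev_ge0 hm p1 _ _.
have e2 : 0 < e / 2 by lra.
have [T T0 hT] := @almost_dirac R n p p1 c (e / 2) c0 e2.
(* The second bound makes the displacement c of f 0 at most e t / 2. *)
pose t := Num.max T (c / (e / 2)).
have tT : T <= t by rewrite le_max lexx.
have t0 : 0 < t := lt_le_trans T0 tT.
have tc : c <= e / 2 * t by rewrite mulrC -ler_pdivrMr// le_max lexx orbT.
have d0 v : euclidean_dist v 0 = 1 -> wass_dist (f (t *: v)) (f 0) = t%:E.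
  by move=> v1; rewrite iso -(scaler0 _ t) euclidean_distZ ?(ltW t0)// v1 mulr1.
have near v : euclidean_dist v 0 = 1 -> rdev (f (t *: v)) heis0 <= t + c.
  by move=> v1; exact: (rdev_le_wass hm p1 heis0 (d0 v v1)).
have /choice[x xP] v : exists a, euclidean_dist v 0 = 1 ->
    rdev (f (t *: v)) a <= e / 2 * t.
  have [v1|nv] := pselect (euclidean_dist v 0 = 1); last by exists heis0.
  have v1' : euclidean_dist (- v) 0 = 1 by rewrite euclidean_dist_opp0.
  have [|a ha] := hT t tT (f (t *: (- v))) (f (t *: v)) (near _ v1') (near _ v1).
    by rewrite iso euclidean_distZ ?(ltW t0)// euclidean_distN v1 mulr1 mulrC.
  by exists a.
have s0 : 0 <= t^-1 by rewrite invr_ge0 ltW.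
exists (fun v => heis_dil t^-1 (x v)) => v v1.
have xv := xP v v1.
split=> [|w w1].
  have u1 : koranyi_norm (x v) <= t + c + e / 2 * t.
    rewrite -(heis_dist0 (x v)); apply: le_trans (rho_le_rdev hm p1 (f (t *: v)) _ _) _.
    by apply: lerD => //; exact: near.
  have u2 : t <= e / 2 * t + koranyi_norm (x v) + c.
    rewrite -lee_fin -(d0 v v1); apply: le_trans (wass_le_rdev hm p1 _ _ heis0) _.
    rewrite lee_fin lerD//; apply: le_trans (rdev_triangle hm p1 _ (x v) heis0) _.
    by rewrite (heis_distC _ heis0) heis_dist0 lerD.
  rewrite koranyi_dil// -(ler_pM2l t0) -[X in X * `|_|](ger0_norm (ltW t0)) -normrM.
  by rewrite mulrBr mulrA mulfV ?gt_eqF// mul1r mulr1 ler_norml; apply/andP; split; lra.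
have xw := xP w w1.
have Wvw : wass_dist (f (t *: v)) (f (t *: w)) = (t * euclidean_dist v w)%:E.
  by rewrite iso euclidean_distZ// ltW.
have u1 : heis_dist (x v) (x w) <= t * euclidean_dist v w + e * t.
  apply: le_trans (rho_le_rdev hm p1 (f (t *: v)) _ _) _.
  have := rdev_le_wass hm p1 (x w) Wvw; lra.
have u2 : t * euclidean_dist v w <= heis_dist (x v) (x w) + e * t.
  rewrite -lee_fin -Wvw; apply: le_trans (wass_le_rdev hm p1 _ _ (x v)) _.
  rewrite lee_fin; have := rdev_triangle hm p1 (f (t *: w)) (x w) (x v).
  rewrite (heis_distC (x w)); lra.
rewrite heis_dist_dil// -(ler_pM2l t0) -[X in X * `|_|](ger0_norm (ltW t0)) -normrM.
by rewrite mulrBr mulrA mulfV ?gt_eqF// mul1r ler_norml; apply/andP; split; lra.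
Qed.

(** The points of e_i and - e_i have norm close to 1 and distance close to 2,
    so [antipode_near] allows replacing the latter by the inverse of the
    former. *)
Lemma embedding_frame (k : nat) (delta : R) : 0 < delta ->
  euclidean_embeds (wass_dist (rho := hd) (p := p)) k ->
  exists y : 'I_k -> H, [/\ forall i, `|koranyi_norm (y i) - 1| <= delta,
    forall i, 2 - delta <= heis_dist (y i) (heis_opp (y i)),
    forall i j, i != j -> `|heis_dist (y i) (y j) - Num.sqrt 2| <= delta &
    forall i j, i != j -> `|heis_dist (heis_opp (y i)) (y j) - Num.sqrt 2| <= delta].
Proof.
move=> d0 [f iso].
have d2 : 0 < delta / 2 by lra.
have [e e0 anti] := antipode_near d2.
have m0 : 0 < Num.min e (delta / 2) by rewrite lt_min e0.
have [x xP] := embedding_unit_sphere m0 iso.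
set m := Num.min e _ in m0 xP.
have me : m <= e by rewrite ge_min lexx.
have md : m <= delta / 2 by rewrite ge_min lexx orbT.
pose u i : 'rV[R]_k := delta_mx ord0 i.
have u1 i : euclidean_dist (u i) 0 = 1 by exact: euclidean_dist_delta0.
have v1 i : euclidean_dist (- u i) 0 = 1 by rewrite euclidean_dist_opp0.
have opp_close i : heis_dist (x (- u i)) (heis_opp (x (u i))) <= delta / 2.
  have [h1 _] := xP _ (u1 i); have [h2 h3] := xP _ (v1 i).
  have := h3 _ (u1 i); rewrite euclidean_distN u1 mulr1.
  move: h1 h2; rewrite !ler_norml => /andP[? ?] /andP[? ?] /andP[? ?].
  by apply: anti; lra.
exists (fun i => x (u i)); split=> [i|i|i j ij|i j ij].
- have [h1 _] := xP _ (u1 i); lra.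
- have [_ h3] := xP _ (v1 i); have := h3 _ (u1 i); rewrite euclidean_distN u1 mulr1.
  rewrite ler_norml => /andP[h1 _]; have h2 := opp_close i.
  have h4 := heis_dist_triangle (x (- u i)) (heis_opp (x (u i))) (x (u i)).
  rewrite (heis_distC (heis_opp (x (u i))) (x (u i))) in h4.
  move: (heis_dist _ _) (heis_dist _ _) (heis_dist _ _) h4 h1 h2 => D1 D2 D3.
  by clear -md; lra.
- have [_ h3] := xP _ (u1 i); have := h3 _ (u1 j).
  have -> : euclidean_dist (u i) (u j) = Num.sqrt 2.
    by rewrite -[u i]scale1r -[u j]scale1r (euclidean_dist_delta 1 1 ij) !expr1n.
  by move=> h; apply: le_trans h _; lra.
have [_ h4] := xP _ (v1 i); have := h4 _ (u1 j).
have -> : euclidean_dist (- u i) (u j) = Num.sqrt 2.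
  rewrite -scaleN1r -[u j]scale1r (euclidean_dist_delta (-1) 1 ij).
  by rewrite sqrrN !expr1n.
have c1 := opp_close i.
have t1 := heis_dist_triangle (x (- u i)) (heis_opp (x (u i))) (x (u j)).
have t2 := heis_dist_triangle (heis_opp (x (u i))) (x (- u i)) (x (u j)).
rewrite (heis_distC (heis_opp (x (u i))) (x (- u i))) in t2.
move: c1 t1 t2; move: (heis_dist (x (- u i)) (heis_opp (x (u i)))) => D1.
move: (heis_dist (heis_opp (x (u i))) (x (u j))) (heis_dist _ _) => D2 D3.
clear -md d0; rewrite !ler_norml => c1 t1 t2 /andP[? ?].
by apply/andP; split; lra.
Qed.

End Config.

(** * Almost orthonormal isotropic families *)

(** If c is in the left kernel of G, the equation at the index of a largest
    entry of c bounds that entry by m e < 1 times itself. *)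
Lemma diag_dominant_row_free (R : realFieldType) (m : nat) (G : 'M[R]_m) (e : R) :
  m%:R * e < 1 -> (forall i j, `|G i j - (i == j)%:R| <= e) -> row_free G.
Proof.
move=> me hG; rewrite -kermx_eq0; apply/eqP/row_matrixP => i0; rewrite row0.
set c := row i0 _.
have cG : c *m G = 0 by rewrite /c -row_mul mulmx_ker row0.
pose i1 := [arg max_(i > i0) `|c ord0 i|]%O.
have i1max i : `|c ord0 i| <= `|c ord0 i1|.
  by rewrite /i1; case: arg_maxP => // j _ hj; exact: hj.
suff c1 : `|c ord0 i1| <= 0.
  apply/rowP => i; rewrite [RHS]mxE; apply/eqP; rewrite -normr_le0.
  exact: le_trans (i1max i) c1.
have cE : c ord0 i1 = - \sum_i c ord0 i * (G i i1 - (i == i1)%:R).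
  have : (c *m G) ord0 i1 = 0 by rewrite cG mxE.
  rewrite mxE => s0.
  under eq_bigr do rewrite mulrBr; rewrite sumrB s0 sub0r opprK.
  rewrite (bigD1 i1)//= eqxx mulr1 big1 ?addr0// => i ii.
  by rewrite (negbTE ii) mulr0.
have : `|c ord0 i1| <= m%:R * e * `|c ord0 i1|.
  rewrite {1}cE normrN; apply: le_trans (ler_norm_sum _ _ _) _.
  apply: (@le_trans _ _ (\sum_(i < m) (`|c ord0 i1| * e))).
    by apply: ler_sum => i _; rewrite normrM ler_pM.
  rewrite sumr_const card_ord -[X in X <= _]mulr_natl; rewrite (_ : m%:R * (_ * e) = m%:R * e * `|c ord0 i1|) //; ring.
have := normr_ge0 (c ord0 i1); nra.
Qed.

Section Gram.
Context {R : realType} {n : nat}.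
Local Notation H := (heisenberg R n).

(** The rows of V are the horizontal parts of the y_i followed by their images
    under the complex structure; the Gram matrix of these 2k vectors of R^(2n)
    is close to the identity, hence has rank 2k. *)
Lemma almost_isotropic_dim (k : nat) (y : 'I_k -> H) (e : R) :
  (k + k)%:R * e < 1 -> (forall i j, `|hdot (y i) (y j) - (i == j)%:R| <= e) ->
  (forall i j, `|hsym (y i) (y j)| <= e) -> (k <= n)%N.
Proof.
move=> ke hd hs.
pose X : 'M[R]_(k, n) := \matrix_(i, l) (y i).1.1 ord0 l.
pose Y : 'M[R]_(k, n) := \matrix_(i, l) (y i).1.2 ord0 l.
pose V := block_mx X Y Y (- X).
have GE : V *m V^T = block_mx (X *m X^T + Y *m Y^T) (X *m Y^T - Y *m X^T)
    (Y *m X^T - X *m Y^T) (Y *m Y^T + X *m X^T).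
  by rewrite /V tr_block_mx mulmx_block linearN/= !mulmxN !mulNmx opprK.
have dE i j : (X *m X^T + Y *m Y^T) i j = hdot (y i) (y j).
  by rewrite !mxE -big_split/=; apply: eq_bigr => l _; rewrite !mxE.
have sE i j : (X *m Y^T - Y *m X^T) i j = - hsym (y i) (y j).
  rewrite !mxE -sumrB -sumrN/=; apply: eq_bigr => l _; rewrite !mxE; ring.
have : row_free (V *m V^T).
  apply: (diag_dominant_row_free ke) => a b; rewrite GE.
  case: (split_ordP a) => i ->; case: (split_ordP b) => j ->.
  - by rewrite block_mxEul dE eq_lshift.
  - by rewrite block_mxEur sE eq_lrshift subr0 normrN.
  - rewrite block_mxEdl eq_rlshift subr0.
    have -> : Y *m X^T - X *m Y^T = - (X *m Y^T - Y *m X^T) by rewrite opprB.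
    by rewrite mxE sE opprK.
  - by rewrite block_mxEdr (addrC (Y *m Y^T)) dE eq_rshift.
rewrite /row_free => /eqP rk.
have := leq_trans (mxrankM_maxl V V^T) (rank_leq_col V).
by rewrite rk !addnn leq_double.
Qed.

End Gram.

Section Limits.
Context {R : realType}.
Implicit Types u v : nat -> R.

Lemma cvg_of_harmonic_bound u (l C : R) :
  (forall m, `|u m - l| <= C * harmonic m) -> u @ \oo --> l.
Proof.
move=> h; suff h0 : (fun m => u m - l) @ \oo --> (0 : R).
  rewrite (_ : u = fun m => (u m - l) + l); last by apply/funext => m; rewrite subrK.
  by rewrite -[X in _ --> X]add0r; apply: cvgD => //; exact: cvg_cst.
apply: norm_cvg0; apply: (@squeeze_cvgr _ _ _ _ (cst 0) (fun m => C * harmonic m)).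
- by apply: nearW => m; rewrite normr_ge0 h.
- exact: cvg_cst.
- by rewrite -[0](mulr0 C); apply: cvgM; [exact: cvg_cst|exact: cvg_harmonic].
Qed.

Lemma cvg_sqr_inv u (l : R) : (forall m, 0 <= u m) -> 0 <= l ->
  (fun m => u m ^+ 2) @ \oo --> l ^+ 2 -> u @ \oo --> l.
Proof.
move=> u0 l0 h.
have -> : u = (fun m => Num.sqrt (u m ^+ 2)).
  by apply/funext => m; rewrite sqrtr_sqr ger0_norm.
rewrite -[l](ger0_norm l0) -sqrtr_sqr.
by apply: (@cvg_comp _ _ _ (fun m => u m ^+ 2) Num.sqrt _ _ _ h); exact: sqrt_continuous.
Qed.

Lemma cvg_sqr0 u : (fun m => u m ^+ 2) @ \oo --> (0 : R) -> u @ \oo --> (0 : R).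
Proof.
move=> h; apply: norm_cvg0; apply: cvg_sqr_inv => //.
rewrite expr0n/=; under eq_fun do rewrite real_normK ?num_real//; exact: h.
Qed.

Lemma cvg_exp u (l : R) d : u @ \oo --> l -> (fun m => u m ^+ d) @ \oo --> l ^+ d.
Proof.
by move=> h; apply: (@cvg_comp _ _ _ u (fun x => x ^+ d) _ _ _ h); exact: exprn_continuous.
Qed.

End Limits.

Section Frame.
Context {R : realType} {n k : nat}.
Local Notation H := (heisenberg R n).

Lemma heis_dist_antipode4 (a : H) :
  heis_dist a (heis_opp a) ^+ 4 = 16 * hdot a a ^+ 2 + 4 * a.2 ^+ 2.
Proof.
have hs : hsym a a = 0 by apply: big1 => i _; ring.
rewrite heis_dist_exp4 hdot_opp hsym_opp hs (hdotC (heis_opp a) a) hdot_opp /=.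
by ring.
Qed.

Lemma heis_dist_opp4 (a b : H) : heis_dist (heis_opp a) b ^+ 4 =
  (hdot a a + hdot b b + 2 * hdot a b) ^+ 2 + (b.2 + a.2 + 2 * hsym a b) ^+ 2.
Proof.
rewrite heis_dist_exp4 hdot_opp (hdotC (heis_opp a) a) hdot_opp.
rewrite (hdotC (heis_opp a) b) hdot_opp (hsymC (heis_opp a) b) hsym_opp.
by rewrite (hdotC b a) (hsymC b a) /=; ring.
Qed.

(** The distance from y_i to its inverse determines its vertical coordinate,
    which tends to 0. Once vertical coordinates are negligible, the fourth
    powers of the distances from y_j to y_i and to the inverse of y_i differ by
    a multiple of the dot product of y_i and y_j, while their sum gives the
    square of the symplectic product. *)
Lemma frame_gram_limit (y : nat -> 'I_k -> H) :
  (forall m i, `|koranyi_norm (y m i) - 1| <= harmonic m) ->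
  (forall m i, 2 - harmonic m <= heis_dist (y m i) (heis_opp (y m i))) ->
  (forall m i j, i != j ->
     `|heis_dist (y m i) (y m j) - Num.sqrt 2| <= harmonic m) ->
  (forall m i j, i != j ->
     `|heis_dist (heis_opp (y m i)) (y m j) - Num.sqrt 2| <= harmonic m) ->
  forall i j, (fun m => hdot (y m i) (y m j)) @ \oo --> ((i == j)%:R : R) /\
              (fun m => hsym (y m i) (y m j)) @ \oo --> (0 : R).
Proof.
move=> hN hE hF hG.
have cN i : (fun m => koranyi_norm (y m i)) @ \oo --> (1 : R).
  by apply: (@cvg_of_harmonic_bound _ _ _ 1) => m; rewrite mul1r.
have cE i : (fun m => heis_dist (y m i) (heis_opp (y m i))) @ \oo --> (2 : R).
  apply: (@cvg_of_harmonic_bound _ _ _ 2) => m.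
  have := hN m i; have := hE m i; rewrite !ler_norml => h1 /andP[h2 h3].
  have := koranyi_dist_le (y m i) (heis_opp (y m i)); rewrite koranyi_opp => h4.
  by apply/andP; split; lra.
have cA2 i : (fun m => hdot (y m i) (y m i) ^+ 2) @ \oo --> (1 : R).
  have -> : (fun m => hdot (y m i) (y m i) ^+ 2) = fun m =>
     12^-1 * (heis_dist (y m i) (heis_opp (y m i)) ^+ 4
              - 4 * koranyi_norm (y m i) ^+ 4).
    by apply/funext => m; rewrite heis_dist_antipode4 koranyi_exp4; field.
  rewrite [X in _ --> X](_ : _ = 12^-1 * (2 ^+ 4 - 4 * 1 ^+ 4)); last by field.
  apply: cvgM; first exact: cvg_cst.
  apply: cvgB; first exact: (@cvg_exp R _ _ 4 (cE i)).
  by apply: cvgM; [exact: cvg_cst|exact: (@cvg_exp R _ _ 4 (cN i))].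
have cA i : (fun m => hdot (y m i) (y m i)) @ \oo --> (1 : R).
  by apply: cvg_sqr_inv => //; [move=> m; exact: hdot_ge0|rewrite expr1n].
have ct2 i : (fun m => (y m i).2 ^+ 2) @ \oo --> (0 : R).
  have -> : (fun m => (y m i).2 ^+ 2) = fun m =>
      koranyi_norm (y m i) ^+ 4 - hdot (y m i) (y m i) ^+ 2.
    by apply/funext => m; rewrite koranyi_exp4; ring.
  rewrite [X in _ --> X](_ : _ = 1 ^+ 4 - 1); last by ring.
  by apply: cvgB; [exact: (@cvg_exp R _ _ 4 (cN i))|exact: cA2].
have ct i : (fun m => (y m i).2) @ \oo --> (0 : R) by exact: (cvg_sqr0 (ct2 i)).
move=> i j; have [->|ij] := eqVneq i j.
  split; first exact: cA.
  rewrite (_ : (fun m => _) = cst 0); first exact: cvg_cst.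
  by apply/funext => m; apply: big1 => l _; ring.
pose F m := heis_dist (y m i) (y m j) ^+ 4.
pose G m := heis_dist (heis_opp (y m i)) (y m j) ^+ 4.
pose S m := hdot (y m i) (y m i) + hdot (y m j) (y m j).
pose P m := hdot (y m i) (y m j).
pose Q m := hsym (y m i) (y m j).
have s4 : Num.sqrt 2 ^+ 4 = 4 :> R.
  by rewrite (exprM _ 2 2) sqr_sqrtr//; ring.
have cF : F @ \oo --> (4 : R).
  rewrite -s4; apply: cvg_exp; apply: (@cvg_of_harmonic_bound _ _ _ 1) => m.
  by rewrite mul1r; exact: hF.
have cG : G @ \oo --> (4 : R).
  rewrite -s4; apply: cvg_exp; apply: (@cvg_of_harmonic_bound _ _ _ 1) => m.
  by rewrite mul1r; exact: hG.
have cS : S @ \oo --> (2 : R) by exact: (cvgD (cA i) (cA j)).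
have FE m : F m = (S m - 2 * P m) ^+ 2 + ((y m j).2 - (y m i).2 - 2 * Q m) ^+ 2.
  exact: heis_dist_exp4.
have GE m : G m = (S m + 2 * P m) ^+ 2 + ((y m j).2 + (y m i).2 + 2 * Q m) ^+ 2.
  exact: heis_dist_opp4.
have ctQ : (fun m => (y m j).2 * Q m) @ \oo --> (0 : R).
  apply: cvg_sqr0.
  apply: (@squeeze_cvgr _ _ _ _ (cst 0) (fun m => (y m j).2 ^+ 2
     * (hdot (y m i) (y m i) * hdot (y m j) (y m j)))).
  - apply: nearW => m; rewrite sqr_ge0 exprMn ler_wpM2l ?sqr_ge0//.
    apply: le_trans (hermitian_cauchy_schwarz _ _).
    by rewrite lerDr sqr_ge0.
  - exact: cvg_cst.
  - rewrite [X in _ --> X](_ : _ = 0 * (1 * 1)); last by ring.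
    exact: (cvgM (ct2 j) (cvgM (cA i) (cA j))).
have cSP : (fun m => S m * P m) @ \oo --> (0 : R).
  have -> : (fun m => S m * P m) = fun m => 8^-1 * (G m - F m
      - (4 * ((y m i).2 * (y m j).2) + 8 * ((y m j).2 * Q m))).
    by apply/funext => m; rewrite FE GE; field.
  rewrite [X in _ --> X](_ : _ = 8^-1 * (4 - 4 - (4 * (0 * 0) + 8 * 0))); last by ring.
  apply: cvgM; first exact: cvg_cst.
  apply: cvgB; first exact: (cvgB cG cF).
  apply: cvgD; apply: cvgM; try exact: cvg_cst; last exact: ctQ.
  exact: (cvgM (ct i) (ct j)).
have cP : P @ \oo --> (0 : R).
  have n2 : 2 != 0 :> R by rewrite pnatr_eq0.
  have h : (fun m => (S m * P m) * (S m)^-1) @ \oo --> (0 : R).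
    rewrite -[X in _ --> X](mul0r 2^-1); apply: cvgM; first exact: cSP.
    exact: (cvgV n2 cS).
  apply: cvg_trans h; apply: near_eq_cvg; near=> m => /=.
  have S0 : S m != 0.
    by near: m; exact: (cvgr_neq0 _ cS n2).
  by rewrite [S m * _]mulrC mulfK.
have cQ : (fun m => (y m i).2 + 2 * Q m) @ \oo --> (0 : R).
  apply: cvg_sqr0.
  have -> : (fun m => ((y m i).2 + 2 * Q m) ^+ 2) = fun m => 2^-1 * (F m + G m)
      - S m ^+ 2 - 4 * P m ^+ 2 - (y m j).2 ^+ 2.
    by apply/funext => m; rewrite FE GE; field.
  rewrite [X in _ --> X](_ : _ = 2^-1 * (4 + 4) - 2 ^+ 2 - 4 * 0 ^+ 2 - 0); last by field.
  apply: cvgB; last exact: ct2.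
  apply: cvgB; first apply: cvgB.
  - by apply: cvgM; [exact: cvg_cst|exact: (cvgD cF cG)].
  - exact: (@cvg_exp R _ _ 2 cS).
  - by apply: cvgM; [exact: cvg_cst|exact: (@cvg_exp R _ _ 2 cP)].
split; first exact: cP.
have -> : (fun m => hsym (y m i) (y m j)) = fun m =>
    2^-1 * ((y m i).2 + 2 * Q m - (y m i).2).
  by apply/funext => m; rewrite /Q; field.
rewrite [X in _ --> X](_ : _ = 2^-1 * (0 - 0)); last by ring.
by apply: cvgM; [exact: cvg_cst|exact: (cvgB cQ (ct i))].
Unshelve. all: by end_near. Qed.

Lemma frames_dim :
  (forall delta : R, 0 < delta -> exists y : 'I_k -> H,
   [/\ forall i, `|koranyi_norm (y i) - 1| <= delta,
    forall i, 2 - delta <= heis_dist (y i) (heis_opp (y i)),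
    forall i j, i != j -> `|heis_dist (y i) (y j) - Num.sqrt 2| <= delta &
    forall i j, i != j -> `|heis_dist (heis_opp (y i)) (y j) - Num.sqrt 2| <= delta])
  -> (k <= n)%N.
Proof.
move=> hframe.
have /choice[y yP] m := hframe (harmonic m) (harmonic_gt0 m).
have lim := @frame_gram_limit y (fun m => let: And4 h _ _ _ := yP m in h)
  (fun m => let: And4 _ h _ _ := yP m in h) (fun m => let: And4 _ _ h _ := yP m in h)
  (fun m => let: And4 _ _ _ h := yP m in h).
pose e : R := ((k + k)%:R + 1)^-1.
have e0 : 0 < e by rewrite invr_gt0 ltr_wpDl.
have [m [h1 h2]] : exists m, (forall i j, `|hdot (y m i) (y m j) - (i == j)%:R| <= e)
    /\ forall i j, `|hsym (y m i) (y m j)| <= e.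
  have near_all : \forall m \near \oo,
      (forall i j, `|hdot (y m i) (y m j) - (i == j)%:R| <= e) /\
      (forall i j, `|hsym (y m i) (y m j)| <= e).
    near=> m; split=> i j.
    - move: i j; near: m; apply: filter_forall => i; apply: filter_forall => j.
      have [/cvgrPdist_le/(_ e e0) h _] := lim i j; move: h.
      by apply: filterS => l; rewrite distrC.
    - move: i j; near: m; apply: filter_forall => i; apply: filter_forall => j.
      by have [_ /cvgr0Pnorm_le/(_ e e0)] := lim i j.
  have [m hm] := filter_ex near_all; by exists m.
apply: (almost_isotropic_dim _ h1 h2).
by rewrite /e ltr_pdivrMr ?mul1r ?ltrDl// ltr_wpDl.
Unshelve. all: by end_near. Qed.

End Frame.

Lemma wasserstein_horizontal_embedding (R : realType) (n k : nat) (p : R) :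
  1 < p -> (k <= n)%N ->
  euclidean_embeds (wass_dist (rho := @heis_dist R n) (p := p)) k.
Proof.
move=> p1 kn.
(* The vectors (u, 0, 0) are horizontal and isotropic. *)
pose pad (u : 'rV[R]_k) : heisenberg R n := (u *m pid_mx k, 0, 0).
exists (fun u => wdirac (@heis_metric R n) p1 (pad u)) => u v.
rewrite wass_dirac; congr EFin.
have padE (w w' : 'rV[R]_k) : hdot (pad w) (pad w') = \sum_(i < k) w ord0 i * w' ord0 i.
  have -> : hdot (pad w) (pad w') = ((pad w).1.1 *m (pad w').1.1^T) ord0 ord0.
    by rewrite !mxE; apply: eq_bigr => i _; rewrite !mxE mulr0 addr0.
  rewrite /pad /= trmx_mul mulmxA -(mulmxA w) tr_pid_mx mul_pid_mx minnn.
  rewrite (minn_idPr kn) pid_mx_1 mulmx1 mxE.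
  by apply: eq_bigr => i _; rewrite !mxE.
have padS (w w' : 'rV[R]_k) : hsym (pad w) (pad w') = 0.
  by apply: big1 => i _; rewrite !mxE !mulr0 subr0.
apply/eqP; rewrite -(@eqrXn2 _ 4) ?heis_dist_ge0 ?sqrtr_ge0//.
rewrite heis_dist_exp4 !padE padS /= (exprM _ 2 2) sqr_sqrtr; last first.
  by apply: sumr_ge0 => i _; exact: sqr_ge0.
rewrite subr0 mulr0 subr0 expr0n addr0; apply/eqP; congr (_ ^+ 2).
rewrite mulr_sumr -big_split -sumrB/=; apply: eq_bigr => i _; ring.
Qed.


Theorem theorem1p1 (R : realType) (n : nat) (p : R)
    (hn : (1 <= n)%N) (hp : 1 < p) :
  let W := wass_dist (rho := @heis_dist R n) (p := p) in
  is_metric_rank W n /\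
  forall k : nat, (0 < k)%N -> (euclidean_embeds W k <-> (k <= n)%N).
Proof.
have rank_le k : euclidean_embeds (wass_dist (rho := @heis_dist R n) (p := p)) k -> (k <= n)%N.
  move=> emb; apply: (@frames_dim R) => delta d0; exact: (embedding_frame hp d0 emb).
split; first by split=> //; exact: wasserstein_horizontal_embedding.
by move=> k _; split; [exact: rank_le|exact: wasserstein_horizontal_embedding].
Qed.
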